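(* Let $4\le p\le n-1$, let $\langle R,S,T\rangle$ be a partition of $V$ (some parts possibly empty) with $0,n\in S$. The generalized max-cut inequality $$x((S:T))+\sum_{i\in R}x(\delta^+(i))\le \left\lfloor \tfrac{p+|R|}{2}\right\rfloor$$ is valid for $P^p_{0,n}(D)$, and it is facet defining for $P^p_{0,n}(D)$ if and only if $p+|R|$ is odd, $|S\setminus\{n\}|>(p-|R|)/2$, $|T|>(p-|R|)/2$, and either (i) $p=|R|+3$, $|R|\ge 2$ and $|S|=3$, or (ii) $p\ge |R|+5$.
   Context: Let $n$ be a positive integer, $V=\{0,1,\dots,n\}$, and let $D=(V,A)$ be the digraph whose arc set $A$ consists of all ordered pairs $(i,j)$ with $i\neq j$, $i,j\in V$, except that no arc enters node $0$, no arc leaves node $n$, and the arc $(0,n)$ is absent. A $(0,n)$-$p$-path is a simple directed path in $D$ from $0$ to $n$ with exactly $p$ arcs. $P^p_{0,n}(D)\subseteq\mathbb{R}^A$ is the convex hull of the incidence vectors of all $(0,n)$-$p$-paths. For $F\subseteq A$, $x(F)=\sum_{(i,j)\in F}x_{ij}$; $\delta^+(k)$ is the set of arcs of $A$ leaving node $k$. For node sets $S,T$, $(S:T)=\{(i,j)\in A: i\in S, j\in T\}$. Facet defining means valid and defining a face of dimension $\dim P^p_{0,n}(D)-1$. *)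

(* Defs.v *)
From HB Require Import structures.
From mathcomp Require Import all_boot all_order all_algebra.
Set Implicit Arguments. Unset Strict Implicit. Unset Printing Implicit Defensive.
Import Order.TTheory GRing.Theory Num.Theory.
Local Open Scope ring_scope.

(* Nodes V = {0,...,n} are 'I_n.+1; node 0 is ord0, node n is ord_max. *)

Definition arcb (n : nat) (a : 'I_n.+1 * 'I_n.+1) : bool :=
  [&& a.1 != a.2, a.2 != ord0, a.1 != ord_max & ~~ ((a.1 == ord0) && (a.2 == ord_max))].

Arguments arcb : clear implicits.

Definition arc (n : nat) := {a : 'I_n.+1 * 'I_n.+1 | arcb n a}.

Definition tl n (a : arc n) : 'I_n.+1 := (val a).1.
Definition hd n (a : arc n) : 'I_n.+1 := (val a).2.

Notation vec R n := (arc n -> R) (only parsing).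

(* A (0,n)-p-path is given by the node sequence 0 :: t (t = nodes after 0):
   simple (uniq), consecutive pairs are arcs, ends at n, exactly p arcs. *)
Definition ppath (n p : nat) (t : seq 'I_n.+1) : bool :=
  [&& size t == p, uniq (ord0 :: t),
      path (fun i j => arcb n (i, j)) ord0 t & last ord0 t == ord_max].

Definition incid (R : realFieldType) (n : nat) (t : seq 'I_n.+1) : vec R n :=
  fun a => if val a \in zip (ord0 :: t) t then 1 else 0.

Arguments incid : clear implicits.
Arguments ppath : clear implicits.

Definition conv (R : realFieldType) n (X : vec R n -> Prop) (x : vec R n) : Prop :=
  exists m (v : 'I_m -> vec R n) (l : 'I_m -> R),
    [/\ forall i, X (v i), forall i, 0 <= l i, \sum_i l i = 1
      & forall a, x a = \sum_i l i * v i a].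

Definition Ppath (R : realFieldType) (n p : nat) : vec R n -> Prop :=
  conv (fun v => exists t, ppath n p t /\ v = incid R n t).

Definition aff_indep (R : realFieldType) n k (f : 'I_k -> vec R n) : Prop :=
  forall c : 'I_k -> R, \sum_i c i = 0 -> (forall a, \sum_i c i * f i a = 0) -> forall i, c i = 0.

Definition affdim_ge (R : realFieldType) n (X : vec R n -> Prop) (k : nat) : Prop :=
  exists f : 'I_k.+1 -> vec R n, (forall i, X (f i)) /\ aff_indep f.

Definition is_affdim (R : realFieldType) n (X : vec R n -> Prop) (d : int) : Prop :=
  (d = -1 /\ forall x, ~ X x) \/
  (exists k : nat, [/\ d = k%:Z, affdim_ge X k & ~ affdim_ge X k.+1]).

Definition valid_ineq (R : realFieldType) n (P : vec R n -> Prop)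
  (phi : vec R n -> R) (b : R) : Prop := forall x, P x -> phi x <= b.

Definition facet_defining (R : realFieldType) n (P : vec R n -> Prop)
  (phi : vec R n -> R) (b : R) : Prop :=
  valid_ineq P phi b /\
  exists d : int, is_affdim P d /\ is_affdim (fun x => P x /\ phi x = b) (d - 1).

Definition gmc_lhs (R : realFieldType) n (Rs Ss Ts : {set 'I_n.+1}) (x : vec R n) : R :=
  \sum_(a : arc n | (tl a \in Ss) && (hd a \in Ts)) x a
  + \sum_(i in Rs) \sum_(a : arc n | tl a == i) x a.

Arguments Ppath : clear implicits.

(* Main.v *)
From HB Require Import structures.
From mathcomp Require Import all_boot all_order all_algebra.
From mathcomp Require Import ring lra zify.
Require Import Defs.
Set Implicit Arguments. Unset Strict Implicit. Unset Printing Implicit Defensive.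
Import Order.TTheory GRing.Theory Num.Theory.
Local Open Scope ring_scope.

(** The maximal number of S-T arcs on a path comes from a parity count. Let a
    path visit [rho] nodes of R, and use [q] arcs in (S:T), [a] arcs in
    (V\S:T) and [b] arcs in (S:V\T). Then T is entered [q + a] times and S is
    left [q + b] times, so [p = rho + 2q + a + b]; as the left-hand side is
    [rho + q], it is at most [(p + |R|)/2], and its deficit is governed by
    [|R| - rho], [a] and [b].

    Necessity: when a condition fails, this count shows that two linear forms
    (an arc never used, a node of R always visited) vanish on all tight paths,
    and they are independent on the polytope.

    Sufficiency: write [p = |R| + 2k + 1]. A tight path is a shuffle of nodes of
    R, of [k] or [k + 1] pairs (s, t) and at most one spare node. A linear form
    [c] vanishing on tight paths may be shifted by a potential so that
    [c 0 v = 0]; moving the spare node, or exchanging an R node with a member of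
    a pair, then determines [c] up to three constants [B], [E], [eps], and such a
    [c] is an affine function of the left-hand side on every p-path. *)

(** * Affine dimension as a matrix rank *)

Section AffineDimension.
Variables (F : realFieldType) (n : nat).
Implicit Types (c l y : arc n -> F).

Definition dot c y : F := \sum_a c a * y a.

Definition family_mx (I : finType) (v : I -> arc n -> F) : 'M[F]_(#|I|, #|{: arc n}|) :=
  \matrix_(i, j) v (enum_val i) (enum_val j).

Definition col_of c : 'cV[F]_#|{: arc n}| := \col_j c (enum_val j).
Definition row_of y : 'rV[F]_#|{: arc n}| := \row_j y (enum_val j).

Lemma row_family_mx (I : finType) (v : I -> arc n -> F) i :
  row i (family_mx v) = row_of (v (enum_val i)).
Proof. by apply/rowP => j; rewrite !mxE. Qed.

Lemma row_of_mul y c : (row_of y *m col_of c) 0 0 = dot c y.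
Proof.
rewrite mxE /dot (reindex (@enum_val _ {: arc n})) /=; last first.
  by apply: onW_bij; apply: enum_val_bij.
by apply: eq_bigr => j _; rewrite !mxE mulrC.
Qed.

Definition in_span (I : finType) (v : I -> arc n -> F) y :=
  exists k : I -> F, forall a, y a = \sum_i k i * v i a.

Lemma in_span_sub (I : finType) (v : I -> arc n -> F) y :
  in_span v y -> (row_of y <= family_mx v)%MS.
Proof.
case=> k yE; apply/submxP; exists (\row_i k (enum_val i)); apply/rowP => j.
rewrite !mxE yE (reindex (@enum_val _ {: I})) /=; last first.
  by apply: onW_bij; apply: enum_val_bij.
by apply: eq_bigr => i _; rewrite !mxE.
Qed.

Section Rank.
Variables (I : finType) (v : I -> arc n -> F) (Y : (arc n -> F) -> Prop) (l : arc n -> F).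
Hypothesis gensY : forall i, Y (v i).
Hypothesis Yspan : forall y, Y y -> in_span v y.
Hypothesis Yhyp : forall y, Y y -> dot l y = 1.

Lemma affdim_ge_rank k : affdim_ge Y k <-> (k < \rank (family_mx v))%N.
Proof.
split=> [[f [fY fI]]|ltk].
  pose B : 'M[F]_(k.+1, _) := \matrix_(i, j) f i (@enum_val _ {: arc n} j).
  have rowB i : row i B = row_of (f i) by apply/rowP => j; rewrite !mxE.
  have freeB : row_free B.
    apply: inj_row_free => u u0.
    have uf a : \sum_i u 0 i * f i a = 0.
      have /rowP/(_ (enum_rank a)) := u0; rewrite !mxE => Bu0; rewrite -[RHS]Bu0.
      by apply: eq_bigr => i _; rewrite mxE enum_rankK.
    have us : \sum_i u 0 i = 0.
      transitivity (\sum_a l a * \sum_i u 0 i * f i a); last first.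
        by apply: big1 => a _; rewrite uf mulr0.
      under eq_bigr do rewrite -[u _ _]mulr1.
      under eq_bigr => i _ do rewrite -(Yhyp (fY i)) /dot mulr_sumr.
      rewrite exchange_big; apply: eq_bigr => a _; rewrite mulr_sumr.
      by apply: eq_bigr => i _; rewrite mulrCA.
    by apply/rowP => i; rewrite [RHS]mxE (fI (u 0) us uf).
  rewrite -(eqP freeB); apply: mxrankS; apply/row_subP => i.
  by rewrite rowB; apply: in_span_sub; apply: Yspan.
set A := family_mx v in ltk *.
pose g (i : 'I_k.+1) := maxrankfun A (widen_ord ltk i).
exists (fun i => v (enum_val (g i))); split=> // c _ c0.
have u0 : \row_j (\sum_(i | widen_ord ltk i == j) c i) *m rowsub (maxrankfun A) A = 0.
  apply/rowP => j; rewrite !mxE -[RHS](c0 (enum_val j)).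
  rewrite (partition_big (widen_ord ltk) xpredT) //=; apply: eq_bigr => i _.
  by rewrite !mxE mulr_suml; apply: eq_bigr => m /eqP<-; rewrite /g.
move=> i; have /row_freeP[C AC] := maxrowsub_free A.
have /(congr1 (mulmx^~ C)) := u0; rewrite -mulmxA AC mulmx1 mul0mx.
move=> /rowP/(_ (widen_ord ltk i)); rewrite !mxE (big_pred1 i) // => m; exact: val_eqE.
Qed.

Lemma is_affdim_rank d : is_affdim Y d <-> d = (\rank (family_mx v))%:Z - 1.
Proof.
split.
  case=> [[-> Y0]|[k [-> /affdim_ge_rank lek /affdim_ge_rank/negP]]]; last first.
    by rewrite -leqNgt => ler; lia.
  suff -> : \rank (family_mx v) = 0%N by [].
  apply/eqP; rewrite mxrank_eq0; apply/eqP/row_matrixP => i.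
  by case: (Y0 (v (enum_val i))).
case: (posnP (\rank (family_mx v))) => [r0 ->|r0 ->].
  rewrite r0; left; split=> // y Yy.
  have /eqP := r0; rewrite mxrank_eq0 => /eqP A0.
  have := in_span_sub (Yspan Yy); rewrite A0 => /submx0null y0.
  by have := Yhyp Yy; rewrite -row_of_mul y0 mul0mx mxE => /esym/eqP; rewrite oner_eq0.
right; exists (\rank (family_mx v)).-1; split; first lia.
- by apply/affdim_ge_rank; lia.
- by move/affdim_ge_rank; lia.
Qed.

End Rank.
End AffineDimension.

(** * Facets by duality *)

Section FacetCriterion.
Variables (F : realFieldType) (n : nat) (I : finType) (v : I -> arc n -> F).
Variables (l h : arc n -> F) (b : F).
Variables (X : (arc n -> F) -> Prop) (phi : (arc n -> F) -> F).
Hypothesis XE : forall y, X y <-> exists i, y = v i.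
Hypothesis phiE : forall y, phi y = dot h y.
Hypothesis v_hyp : forall i, dot l (v i) = 1.
Hypothesis v_valid : forall i, dot h (v i) <= b.

Let tight i := dot h (v i) == b.
Let vT (i : {i | tight i}) := v (val i).

Lemma dot_comb (c y : arc n -> F) m (w : 'I_m -> arc n -> F) (k : 'I_m -> F) :
  (forall a, y a = \sum_i k i * w i a) -> dot c y = \sum_i k i * dot c (w i).
Proof.
move=> yE; rewrite /dot; under [RHS]eq_bigr do rewrite mulr_sumr.
rewrite exchange_big /=; apply: eq_bigr => a _; rewrite yE mulr_sumr.
by apply: eq_bigr => i _; rewrite mulrCA.
Qed.

Lemma conv_gen (Z : (arc n -> F) -> Prop) y : Z y -> conv Z y.
Proof.
move=> Zy; exists 1%N, (fun _ => y), (fun _ => 1); split=> //.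
- by rewrite big_ord1.
- by move=> a; rewrite big_ord1 mul1r.
Qed.

Lemma conv_dot y : conv X y -> dot l y = 1 /\ dot h y <= b.
Proof.
case=> m [w [k [Xw k0 k1 yE]]]; rewrite !(dot_comb _ yE); split.
  by rewrite -[RHS]k1; apply: eq_bigr => i _; have /XE[j ->] := Xw i; rewrite v_hyp mulr1.
rewrite -[leRHS]mul1r -k1 mulr_suml; apply: ler_sum => i _.
by apply: ler_wpM2l => //; have /XE[j ->] := Xw i.
Qed.

Lemma conv_valid : valid_ineq (conv X) phi b.
Proof. by move=> y /conv_dot[_]; rewrite phiE. Qed.

Lemma in_span_gens (K : finType) (f : K -> I) (y : arc n -> F) m (idx : 'I_m -> K) (k : 'I_m -> F) :
  (forall a, y a = \sum_i k i * v (f (idx i)) a) -> in_span (fun j => v (f j)) y.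
Proof.
move=> yE; exists (fun j => \sum_(i | idx i == j) k i) => a.
rewrite yE (partition_big idx xpredT) //=; apply: eq_bigr => j _.
by rewrite mulr_suml; apply: eq_bigr => i /eqP->.
Qed.

Lemma conv_span y : conv X y -> in_span v y.
Proof.
case=> m [w [k [Xw k0 k1 yE]]].
have /fin_all_exists[idx wE] : forall i, exists j, w i = v j by move=> i; apply/XE.
apply: (@in_span_gens I id y m idx k) => a; rewrite yE.
by apply: eq_bigr => i _; rewrite wE.
Qed.

Lemma face_span y : conv X y /\ phi y = b -> in_span vT y.
Proof.
case=> [[m [w [k [Xw k0 k1 yE]]]] phib].
have /fin_all_exists[idx wE] : forall i, exists j, w i = v j by move=> i; apply/XE.
have gap0 : \sum_i k i * (b - dot h (w i)) = 0.
  under eq_bigr do rewrite mulrBr.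
  by rewrite big_split /= sumrN -mulr_suml k1 mul1r -(dot_comb _ yE) -phiE phib subrr.
have gap_ge0 i : 0 <= k i * (b - dot h (w i)) by rewrite mulr_ge0 // subr_ge0 wE.
have kT i : k i != 0 -> tight (idx i).
  move=> ki; have /eqP := gap0; rewrite psumr_eq0 // => /allP/(_ i).
  rewrite mem_index_enum => /(_ isT)/=; rewrite mulf_eq0 (negPf ki) /= subr_eq0.
  by rewrite wE eq_sym.
have [i0 k_i0] : exists i, k i != 0.
  apply/existsP; case: (boolP [exists i, k i != 0]) => // /existsPn k_eq0.
  have := k1; rewrite big1 => [/esym/eqP|i _]; first by rewrite oner_eq0.
  by apply/eqP; rewrite -[_ == _]negbK.
pose jdx i : {j | tight j} := insubd (exist _ (idx i0) (kT _ k_i0)) (idx i).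
apply: (@in_span_gens _ val y m jdx k) => a; rewrite yE; apply: eq_bigr => i _.
have [-> | ki] := eqVneq (k i) 0; first by rewrite !mul0r.
by rewrite wE /jdx val_insubd kT.
Qed.

Lemma facet_rank : facet_defining (conv X) phi b <->
  \rank (family_mx v) = (\rank (family_mx vT)).+1.
Proof.
have rP d : is_affdim (conv X) d <-> d = (\rank (family_mx v))%:Z - 1.
  apply: (@is_affdim_rank _ _ _ _ _ l) => [i|y /conv_span|y /conv_dot[]] //.
  by apply: conv_gen; apply/XE; exists i.
have rF d : is_affdim (fun y => conv X y /\ phi y = b) d <->
    d = (\rank (family_mx vT))%:Z - 1.
  apply: (@is_affdim_rank _ _ _ _ _ l) => [i|y /face_span|y [/conv_dot[]]] //.
  split; first by apply: conv_gen; apply/XE; exists (val i).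
  by rewrite phiE; apply/eqP; apply: (valP i).
split=> [[_ [d [/rP -> /rF]]]|r1]; first lia.
split; first exact: conv_valid.
by exists ((\rank (family_mx v))%:Z - 1); split; [apply/rP|apply/rF; lia].
Qed.

Lemma family_mul (K : finType) (w : K -> arc n -> F) c :
  family_mx w *m col_of c = \col_i dot c (w (enum_val i)).
Proof.
by apply/matrixP => i j; rewrite ord1 [RHS]mxE -row_of_mul -row_family_mx -row_mul [RHS]mxE.
Qed.

Lemma family_vT_sub : (family_mx vT <= family_mx v)%MS.
Proof.
apply/row_subP => i; rewrite row_family_mx; apply: in_span_sub.
by exists (fun j => (j == val (enum_val i))%:R) => a; rewrite (bigD1 (val (enum_val i))) //= eqxx
     mul1r big1 ?addr0 // => j /negPf->; rewrite mul0r.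
Qed.

Lemma vec_row_sub i : (row_of (v i) <= family_mx v)%MS.
Proof. by rewrite -(enum_rankK i) -row_family_mx row_sub. Qed.

Lemma not_facet (c1 c2 : arc n -> F) i1 i2 :
  (forall i, tight i -> dot c1 (v i) = 0) -> (forall i, tight i -> dot c2 (v i) = 0) ->
  dot c1 (v i1) != 0 -> dot c2 (v i1) = 0 -> dot c2 (v i2) != 0 ->
  ~ facet_defining (conv X) phi b.
Proof.
move=> z1 z2 n11 z21 n22 /facet_rank rE.
pose G := row_mx (col_of c1) (col_of c2).
pose B := col_mx (row_of (v i1)) (row_of (v i2)).
have entry c i : row_of (v i) *m col_of c = (dot c (v i))%:M.
  by apply/matrixP => x y; rewrite !ord1 row_of_mul mxE eqxx mulr1n.
have BG_unit : B *m G \in unitmx.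
  rewrite /B /G mul_col_row !entry z21 unitmxE.
  by rewrite raddf0 det_lblock !det_scalar1 unitfE mulf_neq0.
have rAG : (2 <= \rank (family_mx v *m G))%N.
  have /eqP <- : \rank (B *m G) == 2%N by rewrite mxrank_unit.
  apply: mxrankS; apply: submxMr.
  by rewrite /B col_mx_sub !vec_row_sub.
have AT0 : family_mx vT *m G = 0.
  rewrite /G mul_mx_row !family_mul.
  have z c : (forall i, tight i -> dot c (v i) = 0) ->
      \col_i dot c (vT (@enum_val _ predT i)) = 0.
    by move=> zc; apply/colP => i; rewrite !mxE zc //; apply: (valP (enum_val i)).
  by rewrite (z c1) // (z c2) // row_mx0.
have : (\rank (family_mx vT) <= \rank (family_mx v :&: kermx G)%MS)%N.
  by apply: mxrankS; rewrite sub_capmx family_vT_sub; apply/sub_kermxP.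
rewrite -ltnS -rE -(mxrank_mul_ker (family_mx v) G) -[X in (_ <= X)%N]add1n leq_add2r.
by rewrite leqNgt rAG.
Qed.

Lemma facet_sufficient i0 : ~~ tight i0 ->
  (forall c : arc n -> F, (forall i, tight i -> dot c (v i) = 0) ->
    exists lam, forall i, dot c (v i) = lam * (dot h (v i) - b)) ->
  facet_defining (conv X) phi b.
Proof.
move=> nt0 Hc; apply/facet_rank.
pose A0 := col_mx (family_mx vT) (row_of (v i0)).
have subA : (family_mx v <= A0)%MS.
  rewrite submxE; move: (cokermx A0) (mulmx_coker A0) => C AC.
  apply/eqP/matrixP => i j.
  pose c (a : arc n) := C (enum_rank a) j.
  have ckE : col j (C) = col_of c.
    by apply/colP => x; rewrite [LHS]mxE [RHS]mxE /c enum_valK.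
  have : A0 *m col_of c = 0 by rewrite -ckE colE mulmxA AC mul0mx.
  rewrite mul_col_mx => A0c; have cT := congr1 usubmx A0c; have c0 := congr1 dsubmx A0c.
  rewrite col_mxKu linear0 in cT; rewrite col_mxKd linear0 in c0.
  have zT i' : tight i' -> dot c (v i') = 0.
    move=> ti'; have /colP/(_ (enum_rank (exist tight i' ti'))) := cT.
    by rewrite family_mul !mxE enum_rankK.
  have [lam lamE] := Hc c zT.
  have /eqP : lam * (dot h (v i0) - b) = 0.
    by rewrite -lamE -row_of_mul c0 mxE.
  rewrite mulf_eq0 subr_eq0 -/(tight i0) (negPf nt0) orbF => /eqP lam0.
  transitivity ((family_mx v *m col j (C)) i 0).
    by rewrite colE mulmxA -colE [RHS]mxE.
  by rewrite ckE family_mul !mxE lamE lam0 mul0r.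
have subA0 : (A0 <= family_mx v)%MS.
  by rewrite /A0 col_mx_sub family_vT_sub vec_row_sub.
have rAE : \rank (family_mx v) = \rank A0.
  by apply/eqP; rewrite eqn_leq !mxrankS.
have ltTA : (family_mx vT < family_mx v)%MS.
  rewrite ltmxE family_vT_sub; apply/negP => /(submx_trans (vec_row_sub i0))/submxP[u uE].
  pose g a := h a - b * l a.
  have gE y : dot g y = dot h y - b * dot l y.
    rewrite /dot mulr_sumr -sumrB; apply: eq_bigr => a _.
    by rewrite /g mulrBl mulrA.
  have := row_of_mul (v i0) g; rewrite uE -mulmxA family_mul.
  rewrite (_ : \col__ _ = 0) ?mulmx0 => [|]; last first.
    apply/colP => x; rewrite !mxE gE v_hyp mulr1.
    by have /eqP-> := valP (enum_val x); rewrite subrr.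
  rewrite mxE gE v_hyp mulr1 => /esym/eqP; rewrite subr_eq0.
  exact/negP.
have ltr := rank_ltmx ltTA.
have leA0 : (\rank A0 <= \rank (family_mx vT) + 1)%N.
  rewrite /A0 -addsmxE; apply: leq_trans (mxrank_adds_leqif _ _).1 _.
  by rewrite leq_add2l rank_leq_row.
by lia.
Qed.

End FacetCriterion.

(** * Paths as words of internal nodes *)

Section Words.
Variable n : nat.
Notation V := 'I_n.+1.
Implicit Types (x y : V) (s t W : seq V).

Definition internal (x : V) := (x != ord0) && (x != ord_max).

(* The path 0 -> W -> n, with p arcs. *)
Definition word p W := [&& size W == p.-1, uniq W & all internal W].

Lemma path_word x W : x != ord_max -> uniq (x :: W) -> all internal W ->
  (x == ord0 -> W != [::]) -> path (fun i j => arcb n (i, j)) x (rcons W ord_max).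
Proof.
elim: W x => [|y W IH] x xN /=.
  move=> _ _ x0; have {}x0 : x != ord0 by apply/negP => /x0.
  rewrite /arcb /= xN (negPf x0) !andbT /=; apply: contraNneq xN => N0.
  by rewrite -val_eqE /=; case: (x) N0 => m /= ltm /(congr1 val)/= n0; lia.
rewrite inE negb_or -andbA => /and3P[xy xW /andP[yW uW]] /andP[/andP[y0 yN] aW] _.
rewrite IH //= ?yW // ?(negPf y0) // andbT /arcb /= xy y0 xN /=.
by rewrite (negPf yN) andbF.
Qed.

Lemma ppath_word p t : (0 < n)%N -> (1 < p)%N ->
  ppath n p t <-> exists2 W, t = rcons W ord_max & word p W.
Proof.
move=> n0 p1; have N0 : ord_max != ord0 :> V by rewrite -val_eqE /= -lt0n.
split=> [/and4P[/eqP st ut pt lt]|[W -> /and3P[/eqP sW uW aW]]].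
  case/lastP: t st ut pt lt => [|W y]; first by case: p p1.
  rewrite size_rcons last_rcons -rcons_cons rcons_uniq => sW /andP[yW uW] _ /eqP yN.
  subst y; exists W => //; rewrite /word -sW eqxx /=.
  move: yW uW; rewrite inE negb_or /= => /andP[_ NW] /andP[zW ->] /=.
  apply/allP => x xW; apply/andP; split; apply/eqP => xE; first by rewrite -xE xW in zW.
  by rewrite -xE xW in NW.
have NW : ord_max \notin W.
  by apply/negP => /(allP aW); rewrite /internal eqxx andbF.
have zW : ord0 \notin W by apply/negP => /(allP aW); rewrite /internal eqxx.
have pW : path (fun i j => arcb n (i, j)) ord0 (rcons W ord_max).
  apply: path_word => //=; [by rewrite eq_sym | by rewrite zW |].
  by case: W sW {uW aW NW zW} => //=; case: p p1 => // -[].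
rewrite /ppath size_rcons last_rcons eqxx pW /= rcons_uniq NW uW sW.
by rewrite mem_rcons inE negb_or [ord0 == _]eq_sym N0 zW prednK ?eqxx // ltnW.
Qed.

Section Cost.
Variable F : realFieldType.
Implicit Types (C : V -> V -> F) (c : arc n -> F).

Fixpoint cost C x s : F := if s is y :: s' then C x y + cost C y s' else 0.

Lemma cost_cat C x s y t : cost C x (s ++ y :: t) = cost C x (rcons s y) + cost C y t.
Proof. by elim: s x => [|z s IH] x /=; rewrite ?addr0 ?IH ?addrA. Qed.

Lemma cost_sum C x s : cost C x s = \sum_(e <- zip (x :: s) s) C e.1 e.2.
Proof.
by elim: s x => [|y s IH] x /=; rewrite ?big_nil // big_cons IH.
Qed.

Lemma cost_potential C (u : V -> F) x s :
  cost (fun i j => C i j + (u i - u j)) x s = cost C x s + (u x - u (last x s)).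
Proof. by elim: s x => [|y s IH] x /=; rewrite ?IH; ring. Qed.

Lemma cost_count (P : V -> V -> bool) x s :
  cost (fun i j => (P i j)%:R) x s = (count (fun e => P e.1 e.2) (zip (x :: s) s))%:R.
Proof. by elim: s x => [|y s IH] x //=; rewrite IH natrD. Qed.

Definition extend c (i j : V) : F := if insub (i, j) is Some a then c a else 0.

Lemma extend_restrict C i j : arcb n (i, j) -> extend (fun a => C (tl a) (hd a)) i j = C i j.
Proof. by move=> aij; rewrite /extend insubT. Qed.

Lemma path_zip (e : rel V) x s : path e x s -> {in zip (x :: s) s, forall a, e a.1 a.2}.
Proof.
elim: s x => [|y s IH] x //= /andP[exy pys] a; rewrite inE => /orP[/eqP->//|].
exact: IH.
Qed.

Lemma dot_incid c p t : ppath n p t -> dot c (incid F n t) = cost (extend c) ord0 t.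
Proof.
case/and4P=> _ ut pt _; rewrite cost_sum big_uniq; last first.
  by apply: (@zip_uniql _ _ (ord0 :: t) t).
rewrite /dot /incid (reindex_omap (val : arc n -> V * V) insub) /=; last first.
  by move=> e /(path_zip pt); rewrite -surjective_pairing => ae; rewrite insubT.
rewrite [RHS]big_mkcond /=; apply: eq_bigr => a _.
rewrite /extend -surjective_pairing valK eqxx andbT.
by case: ifP; rewrite ?mulr1 ?mulr0.
Qed.

Lemma dot_incid_restrict C p t : ppath n p t ->
  dot (fun a => C (tl a) (hd a)) (incid F n t) = cost C ord0 t.
Proof.
move=> pt; rewrite (dot_incid _ pt) !cost_sum; apply: eq_big_seq => e.
case/and4P: pt => _ _ pt _ /(path_zip pt); rewrite -surjective_pairing => ae.
by rewrite extend_restrict // -surjective_pairing.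
Qed.

End Cost.
End Words.
Arguments internal {n} x.

Lemma size_filter_notin (T : finType) (A : {set T}) (L : seq T) : uniq L ->
  size [seq x <- enum A | x \notin L] = (#|A| - count (mem A) L)%N.
Proof.
move=> uL; have := count_predC (mem L) (enum A); rewrite -cardE => <-.
have -> : count (mem A) L = count (mem L) (enum A).
  rewrite -!size_filter; apply: perm_size; apply: uniq_perm.
  - exact: filter_uniq.
  - exact/filter_uniq/enum_uniq.
  by move=> x; rewrite [LHS]mem_filter [RHS]mem_filter mem_enum andbC.
by rewrite addKn size_filter.
Qed.

Lemma count_mem_le (T : finType) (A : {set T}) (L : seq T) : uniq L -> (count (mem A) L <= #|A|)%N.
Proof.
move=> uL; rewrite -size_filter cardE; apply: uniq_leq_size => [|x].
  exact: filter_uniq.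
by rewrite mem_filter mem_enum => /andP[].
Qed.

Fixpoint interleave (T : Type) (s t : seq T) : seq T :=
  if s is x :: s' then if t is y :: t' then x :: y :: interleave s' t' else [::] else [::].

Lemma perm_interleave (T : eqType) (s t : seq T) : size s = size t ->
  perm_eq (interleave s t) (s ++ t).
Proof.
elim: s t => [|x s IH] [|y t] //= [/IH pst].
rewrite perm_cons (perm_trans _ (_ : perm_eq (y :: s ++ t) _)) //.
  by rewrite perm_cons.
by rewrite perm_sym -cat_rcons -cat1s catA perm_cat2r perm_rcons.
Qed.

Lemma exists_other (T : finType) (A : {set T}) x : (1 < #|A|)%N -> exists2 y, y \in A & y != x.
Proof.
move=> A1; have /card_gt0P[y] : (0 < #|A :\ x|)%N.
  by move: A1; rewrite (cardsD1 x A); case: (x \in A) => //; apply: ltnW.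
by rewrite !inE => /andP[yx yA]; exists y.
Qed.

Lemma exists_third (T : finType) (A : {set T}) x y :
  (2 < #|A|)%N -> exists z, [/\ z \in A, z != x & z != y].
Proof.
move=> A2; have A1 : (1 < #|A :\ x|)%N 
    by move: A2; rewrite (cardsD1 x A); case: (x \in A) => //; apply: ltnW.
have [z] := exists_other y A1; rewrite !inE => /andP[zx zA] zy.
by exists z.
Qed.

Lemma mem_zip2 (T1 T2 : eqType) (A : seq T1) (B : seq T2) x y :
  (x, y) \in zip A B -> (x \in A) && (y \in B).
Proof.
elim: A B => [|a A IH] [|b B] //=; rewrite !inE xpair_eqE.
by case/orP=> [/andP[-> ->] //|/IH/andP[-> ->]]; rewrite !orbT.
Qed.

Section Partition.
Variables (n : nat) (Rs Ss Ts : {set 'I_n.+1}).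
Notation V := 'I_n.+1.
Notation N := (@ord_max n).
Hypothesis n_gt0 : (0 < n)%N.
Hypothesis dRS : [disjoint Rs & Ss].
Hypothesis dRT : [disjoint Rs & Ts].
Hypothesis dST : [disjoint Ss & Ts].
Hypothesis cover_RST : Rs :|: Ss :|: Ts = [set: V].
Hypothesis S0 : ord0 \in Ss.
Hypothesis SN : N \in Ss.
Implicit Types (x y z : V) (W L : seq V).

Definition inner_S : {set V} := Ss :\ ord0 :\ N.

(* Tuples of equations, so that [rewrite] evaluates all memberships at once. *)
Definition nodeR x :=
  (((x \in Rs) = true) * ((x \in Ss) = false) * ((x \in Ts) = false) * (internal x = true))%type.
Definition nodeS x :=
  (((x \in Rs) = false) * ((x \in Ss) = true) * ((x \in Ts) = false) * (internal x = true))%type.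
Definition nodeT x :=
  (((x \in Rs) = false) * ((x \in Ss) = false) * ((x \in Ts) = true) * (internal x = true))%type.

Lemma internal_notin_S x : x \notin Ss -> internal x.
Proof. by move=> xS; apply/andP; split; apply: contraNneq xS => ->. Qed.

Lemma in_nodeR x : x \in Rs -> nodeR x.
Proof.
by move=> xR; rewrite /nodeR xR (disjointFr dRS xR) (disjointFr dRT xR) internal_notin_S
  ?(disjointFr dRS xR).
Qed.

Lemma in_nodeT x : x \in Ts -> nodeT x.
Proof.
by move=> xT; rewrite /nodeT xT (disjointFl dRT xT) (disjointFl dST xT) internal_notin_S
  ?(disjointFl dST xT).
Qed.

Lemma in_nodeS x : x \in Ss -> internal x -> nodeS x.
Proof. by move=> xS ix; rewrite /nodeS xS ix (disjointFl dRS xS) (disjointFr dST xS). Qed.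

Lemma inner_SE x : (x \in inner_S) = (x \in Ss) && internal x.
Proof. by rewrite !inE /internal; case: (x \in Ss); rewrite ?andbF // andbT andbC. Qed.

Lemma in_inner_S x : x \in inner_S -> nodeS x.
Proof. by rewrite inner_SE => /andP[]; apply: in_nodeS. Qed.

Variant kind_spec x : Type :=
  | KindR of nodeR x | KindS of nodeS x | KindT of nodeT x.

Lemma kindP x : internal x -> kind_spec x.
Proof.
move=> ix; case: (boolP (x \in Rs)) => [/in_nodeR xR|xR]; first exact: KindR.
case: (boolP (x \in Ss)) => [xS|xS]; first exact/KindS/in_nodeS.
have : x \in Rs :|: Ss :|: Ts by rewrite cover_RST inE.
by rewrite !inE (negPf xR) (negPf xS) /= => /in_nodeT xT; apply: KindT.
Qed.

Lemma ord_max_notin_T : (N \in Ts) = false.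
Proof. exact: disjointFr dST SN. Qed.

Lemma ord0_notin_R : (ord0 \in Rs) = false.
Proof. exact: disjointFl dRS S0. Qed.

Lemma N_neq0 : (N == ord0) = false.
Proof. by apply/negbTE; rewrite -val_eqE /= -lt0n. Qed.

Lemma card_inner_S : #|Ss| = #|inner_S|.+2.
Proof.
by rewrite (cardsD1 ord0) S0 (cardsD1 N (Ss :\ ord0)) !inE N_neq0 SN.
Qed.

Lemma card_S_notN : #|Ss :\ N| = #|inner_S|.+1.
Proof. by have := cardsD1 N Ss; rewrite SN card_inner_S => -[]. Qed.

Definition gmc (x y : V) : bool := (x \in Rs) || (x \in Ss) && (y \in Ts).

(* The left-hand side of the inequality on the path W -> n. *)
Fixpoint gmcw W : nat :=
  if W is x :: W' then
    (x \in Rs) + ((x \in Ss) && (head N W' \in Ts)) + gmcw W' else 0.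

Lemma gmcwE x W : gmcw (x :: W) =
  count (fun e => gmc e.1 e.2) (zip (x :: rcons W N) (rcons W N)).
Proof.
elim: W x => [|y W IH] x.
  by rewrite /= ord_max_notin_T /gmc /= ord_max_notin_T !andbF orbF !addn0.
rewrite [LHS]/= -/(gmcw (y :: W)) IH [RHS]/= /gmc; congr (_ + _)%N.
case: (boolP (x \in Rs)) => [xR|//]; by rewrite (disjointFr dRS xR).
Qed.

Lemma gmcw_cat_R A W : all (mem Rs) A -> gmcw (A ++ W) = (size A + gmcw W)%N.
Proof.
elim: A => //= x A IH /andP[xR aA]; rewrite IH //.
by have [[[-> ->] _] _] := in_nodeR xR.
Qed.

Lemma gmcw_interleave B C W : size B = size C -> all (mem inner_S) B -> all (mem Ts) C ->
  gmcw (interleave B C ++ W) = (size B + gmcw W)%N.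
Proof.
elim: B C => [|s B IH] [|t C] //= [sBC] /andP[/in_inner_S sS aB] /andP[/in_nodeT tT aC].
by rewrite !sS !tT IH.
Qed.

(* An arrangement of all nodes of R outside L followed by m pairs (s, t) that
   avoid L, used to complete a short pattern on L to a tight path. *)
Record filler (L : seq V) (m : nat) (Wf : seq V) : Prop := Filler {
  filler_uniq : uniq Wf;
  filler_internal : all internal Wf;
  filler_notin : all (fun x => x \notin L) Wf;
  filler_size : size Wf = (#|Rs| - count (mem Rs) L + 2 * m)%N;
  filler_gmcw : forall W, gmcw (Wf ++ W) = (#|Rs| - count (mem Rs) L + m + gmcw W)%N;
  filler_head : forall W, (head N W \in Ts) = false -> (head N (Wf ++ W) \in Ts) = false
}.

Lemma filler_exists L m : uniq L ->
  (count (mem inner_S) L + m <= #|inner_S|)%N -> (count (mem Ts) L + m <= #|Ts|)%N ->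
  exists Wf, filler L m Wf.
Proof.
move=> uL mS mT.
pose A := [seq x <- enum Rs | x \notin L].
pose B := take m [seq x <- enum inner_S | x \notin L].
pose C := take m [seq x <- enum Ts | x \notin L].
have sB : size B = m.
  by rewrite size_takel // size_filter_notin // leq_subRL // (leq_trans _ mS) ?leq_addr.
have sC : size C = m.
  by rewrite size_takel // size_filter_notin // leq_subRL // (leq_trans _ mT) ?leq_addr.
have aA : all (mem Rs) A by apply/allP => x; rewrite mem_filter mem_enum => /andP[].
have aB : all (mem inner_S) B.
  by apply/allP => x /mem_take; rewrite mem_filter mem_enum => /andP[].
have aC : all (mem Ts) C.
  by apply/allP => x /mem_take; rewrite mem_filter mem_enum => /andP[].
have pW : perm_eq (A ++ interleave B C) (A ++ B ++ C).
  by rewrite perm_cat2l perm_interleave // sB.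
have uf (K : {set V}) : uniq [seq x <- enum K | x \notin L].
  exact/filter_uniq/enum_uniq.
have uA : uniq A by apply: uf.
have uB : uniq B by apply/take_uniq/uf.
have uC : uniq C by apply/take_uniq/uf.
exists (A ++ interleave B C); split.
- rewrite (perm_uniq pW) !cat_uniq -all_predC uA uB uC.
  rewrite andbT -all_predC /=; apply/andP; split.
    rewrite all_cat; apply/andP; split.
      by apply: sub_all aB => x /in_inner_S xS; rewrite /= mem_filter mem_enum xS andbF.
    by apply: sub_all aC => x /in_nodeT xT; rewrite /= mem_filter mem_enum xT andbF.
  apply: sub_all aC => x /in_nodeT xT /=; apply/negP => /(allP aB).
  by move=> /in_inner_S; case=> [[[_]]]; rewrite xT.
- rewrite (perm_all _ pW) !all_cat; apply/and3P; split.
  + by apply: sub_all aA => x /in_nodeR ->.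
  + by apply: sub_all aB => x /in_inner_S ->.
  + by apply: sub_all aC => x /in_nodeT ->.
- rewrite (perm_all _ pW) !all_cat; apply/and3P; split; apply/allP => x.
  + by rewrite mem_filter => /andP[].
  + by move=> /mem_take; rewrite mem_filter => /andP[].
  + by move=> /mem_take; rewrite mem_filter => /andP[].
- by rewrite (perm_size pW) !size_cat sB sC size_filter_notin // addnn mul2n.
- move=> W; rewrite -catA gmcw_cat_R // gmcw_interleave ?sB ?sC // size_filter_notin //.
  by rewrite addnA.
- move=> W hW; case: A aA {pW uA} => [_|x A /andP[/in_nodeR xR _]] /=; last by rewrite xR.
  case: B C aB {aC sB sC uB uC} => [|s B] [|t C] //= /andP[/in_inner_S sS _].
  by rewrite sS.
Qed.

Lemma filler_word p L m Wf P1 P2 : filler L m Wf -> uniq (P1 ++ P2) ->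
  all internal (P1 ++ P2) -> all (mem L) (P1 ++ P2) ->
  (size P1 + size P2 + (#|Rs| - count (mem Rs) L + 2 * m) = p.-1)%N ->
  word p (P1 ++ Wf ++ P2).
Proof.
move=> fW uP iP LP sP; have pW : perm_eq (P1 ++ Wf ++ P2) (Wf ++ P1 ++ P2).
  by rewrite perm_catCA.
rewrite /word (perm_size pW) (perm_uniq pW) (perm_all _ pW) !size_cat (filler_size fW).
rewrite cat_uniq (filler_uniq fW) uP andbT all_cat (filler_internal fW) iP /= !andbT.
rewrite -sP addnC eqxx /=; apply/hasPn => x /(allP LP) xL.
by apply/negP => /(allP (filler_notin fW))/negP; apply.
Qed.

End Partition.

(** * Exchange arguments on tight paths *)

Section Exchange.
Variables (F : realFieldType) (n p k r : nat) (Rs Ss Ts : {set 'I_n.+1}).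
Notation V := 'I_n.+1.
Notation N := (@ord_max n).
Hypothesis n_gt0 : (0 < n)%N.
Hypothesis dRS : [disjoint Rs & Ss].
Hypothesis dRT : [disjoint Rs & Ts].
Hypothesis dST : [disjoint Ss & Ts].
Hypothesis cover_RST : Rs :|: Ss :|: Ts = [set: V].
Hypothesis S0 : ord0 \in Ss.
Hypothesis SN : N \in Ss.
Notation nodeR := (nodeR Rs Ss Ts).
Notation nodeS := (nodeS Rs Ss Ts).
Notation nodeT := (nodeT Rs Ss Ts).
Notation filler := (filler Rs Ss Ts).
Notation gmcw := (gmcw Rs Ss Ts).
Notation Si := (inner_S Ss).
Hypothesis rE : #|Rs| = r.
(* With p + r odd, the bound is r + k, k being the number of S-T arcs of a
   path that visits all of R. *)
Hypothesis pE : p = (r + 2 * k).+1.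
Hypothesis k_gt0 : (0 < k)%N.
Hypothesis le_k_S : (k <= #|Si|)%N.
Hypothesis lt_k_T : (k < #|Ts|)%N.
(* A form vanishing on tight paths, normalised by a potential. *)
Variable c : V -> V -> F.
Hypothesis c0 : forall v, c ord0 v = 0.
Hypothesis tight0 : forall W, word p W -> gmcw (ord0 :: W) = (r + k)%N ->
  cost c ord0 (rcons W N) = 0.
Notation e v := (c v N).

Lemma neq_of_kind x y : ((x \in Ss) != (y \in Ss)) || ((x \in Ts) != (y \in Ts)) -> x != y.
Proof. by apply: contraL => /eqP->; rewrite !eqxx. Qed.

Lemma tight_fill L m : uniq L ->
  (count (mem Si) L + m <= k)%N -> (count (mem Ts) L + m <= k.+1)%N ->
  exists Wf, [/\ forall W, gmcw (Wf ++ W) = (r - count (mem Rs) L + m + gmcw W)%N,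
    forall W, (head N (Wf ++ W) \in Ts) = (Wf == [::]) && (head N W \in Ts) &
    forall P1 P2, uniq (P1 ++ P2) -> all internal (P1 ++ P2) -> all (mem L) (P1 ++ P2) ->
      (size P1 + size P2 + (r - count (mem Rs) L + 2 * m) = r + 2 * k)%N ->
      gmcw (ord0 :: P1 ++ Wf ++ P2) = (r + k)%N ->
      cost c ord0 (rcons (P1 ++ Wf ++ P2) N) = 0].
Proof.
move=> uL mS mT.
have [Wf fW] := filler_exists dRS dRT dST S0 SN uL (leq_trans mS le_k_S) (leq_trans mT lt_k_T).
exists Wf; split=> [W|W|P1 P2 uP iP LP sP gP].
- by rewrite (filler_gmcw fW) rE.
- case: (Wf) (filler_head fW) => [//|x Wf'] hW; apply: (hW [::]).
  exact: (ord_max_notin_T dST SN).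
by apply: tight0 gP; apply: (filler_word fW uP iP LP); rewrite rE sP pE.
Qed.

Lemma count_R_le L : uniq L -> (count (mem Rs) L <= r)%N.
Proof.
by rewrite -rE; apply: count_mem_le.
Qed.

Ltac kinds :=
  repeat match goal with
  | K : is_true (in_mem _ _) |- _ =>
    first [ move: (in_inner_S dRS dST K) | move: (in_nodeT dRT dST S0 SN K)
          | move: (in_nodeR dRS dRT S0 SN K) ]; clear K; intro K
  end.

Ltac usekinds :=
  repeat match goal with
  | K : nodeR _ |- _ => progress rewrite ?K
  | K : nodeS _ |- _ => progress rewrite ?K
  | K : nodeT _ |- _ => progress rewrite ?K
  end.

Ltac distinct :=
  rewrite /= ?inE ?negb_or -?andbA;
  repeat (apply/andP; split); try done;
  first [ done | by rewrite eq_sym | by apply: neq_of_kind; usekinds ].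

Ltac arith :=
  repeat match goal with K : is_true (leq _ _) |- _ => revert K end; clear; lia.

Ltac fill L m Wf gW hW tW :=
  let uL := fresh "uL" in let rL := fresh "rL" in
  assert (uL : uniq L) by distinct;
  assert (rL := count_R_le uL);
  revert rL; rewrite /=; usekinds; intro rL;
  destruct (@tight_fill L m uL) as [Wf [gW hW tW]];
  [ rewrite /= !inner_SE; usekinds; rewrite /=; arith
  | rewrite /=; usekinds; rewrite /=; arith
  | revert gW tW; rewrite /=; usekinds; intros gW tW; clear uL ].

Ltac tight P1 Wf P2 gW hW tW :=
  let H := fresh "H" in
  assert (H : cost c ord0 (rcons (P1 ++ Wf ++ P2) N) = 0);
  [ apply: tW;
    [ distinct | by rewrite /=; usekinds | by rewrite /= !inE !eqxx ?orbT | rewrite /=; arith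
    | rewrite /= ?gW (ord0_notin_R dRS S0) S0 /=; usekinds; rewrite ?hW /=; usekinds;
      rewrite ?(ord_max_notin_T dST SN) ?andbF /=; usekinds; arith ]
  | revert H; rewrite rcons_cat /= c0 ?rcons_cat ?rcons_cons ?cost_cat /= ].

(* In the word t B_1 ... B_m with all of R and k - 1 pairs, the spare node x can
   be inserted in front, at the end, or between two blocks. *)
Lemma insert_end_R x t w : (x \in Si) || (x \in Ts) -> t \in Ts -> w \in Rs -> x != t ->
  c x t + e w = c w x + e x.
Proof.
case/orP=> xK tT wR xt; kinds; fill [:: x; t; w] k.-1 Wf gW hW tW;
  tight [:: x; t] Wf [:: w] gW hW tW; tight [:: t] Wf [:: w; x] gW hW tW; lra.
Qed.

Lemma insert_end_T x t z s : (1 < k)%N -> x \in Si -> t \in Ts -> z \in Ts -> s \in Si ->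
  t != z -> x != s -> c x t + e z = c z x + e x.
Proof.
move=> k1 xS tT zT sS tz xs; kinds; fill [:: x; t; s; z] k.-2 Wf gW hW tW.
tight [:: x; t] Wf [:: s; z] gW hW tW; tight [:: t] Wf [:: s; z; x] gW hW tW; lra.
Qed.

Lemma insert_front s x t : s \in Si -> x \in Ts -> t \in Ts -> x != t -> c s t = c x t.
Proof.
move=> sS xT tT xt; kinds; fill [:: s; x; t] k.-1 Wf gW hW tW.
tight [:: s; t] Wf (@nil V) gW hW tW; tight [:: x; t] Wf (@nil V) gW hW tW; lra.
Qed.

Lemma insert_TS x t s t' : (1 < k)%N -> (x \in Si) || (x \in Ts) -> t \in Ts -> s \in Si ->
  t' \in Ts -> x != t -> x != s -> t' != t -> t' != x -> c x t + c t s = c t x + c x s.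
Proof.
move=> k1 /orP[]xK tT sS tT' xt xs tt' tx'; kinds;
  fill [:: x; t; s; t'] k.-2 Wf gW hW tW;
  tight [:: x; t; s; t'] Wf (@nil V) gW hW tW; tight [:: t; x; s; t'] Wf (@nil V) gW hW tW; lra.
Qed.

Lemma insert_RR x t w w' : (x \in Si) || (x \in Ts) -> t \in Ts -> w \in Rs -> w' \in Rs ->
  x != t -> w != w' -> c x t + c w w' = c w x + c x w'.
Proof.
case/orP=> xK tT wR wR' xt ww; kinds; fill [:: x; t; w; w'] k.-1 Wf gW hW tW;
  tight [:: x; t; w; w'] Wf (@nil V) gW hW tW; tight [:: t; w; x; w'] Wf (@nil V) gW hW tW; lra.
Qed.

Lemma insert_TR x t w : (x \in Si) || (x \in Ts) -> t \in Ts -> w \in Rs ->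
  x != t -> c x t + c t w = c t x + c x w.
Proof.
case/orP=> xK tT wR xt; kinds; fill [:: x; t; w] k.-1 Wf gW hW tW;
  tight [:: x; t; w] Wf (@nil V) gW hW tW; tight [:: t; x; w] Wf (@nil V) gW hW tW; lra.
Qed.

Lemma swap_S s1 s2 t1 t2 : (1 < k)%N -> s1 \in Si -> s2 \in Si -> t1 \in Ts -> t2 \in Ts ->
  s1 != s2 -> t1 != t2 ->
  c s1 t1 + c t1 s2 + c s2 t2 = c s2 t1 + c t1 s1 + c s1 t2.
Proof.
move=> k1 s1S s2S t1T t2T s12 t12; kinds; fill [:: s1; t1; s2; t2] k.-2 Wf gW hW tW.
tight [:: s1; t1; s2; t2] Wf (@nil V) gW hW tW; tight [:: s2; t1; s1; t2] Wf (@nil V) gW hW tW; lra.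
Qed.

(* Trading a pair (s, t') for the R node w and a spare node; w is skipped by the
   first of the two paths. *)
Lemma replace_TS t s t' w : t \in Ts -> s \in Si -> t' \in Ts -> w \in Rs -> t != t' ->
  c t s + c s t' = c t w + c w t'.
Proof.
move=> tT sS tT' wR tt; kinds; fill [:: t; s; t'; w] k.-1 Wf gW hW tW.
tight [:: t; s; t'] Wf (@nil V) gW hW tW; tight [:: t; w; t'] Wf (@nil V) gW hW tW; lra.
Qed.

Lemma replace_end t s t' w : t \in Ts -> s \in Si -> t' \in Ts -> w \in Rs -> t != t' ->
  c s t' + e t' = c s w + e w.
Proof.
move=> tT sS tT' wR tt; kinds; fill [:: t; s; t'; w] k.-1 Wf gW hW tW.
tight [:: t] Wf [:: s; t'] gW hW tW; tight [:: t] Wf [:: s; w] gW hW tW; lra.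
Qed.

Lemma replace_RS t s t' w w' : t \in Ts -> s \in Si -> t' \in Ts -> w \in Rs -> w' \in Rs ->
  t != t' -> w != w' -> c w' s + c s t' = c w' w + c w t'.
Proof.
move=> tT sS tT' wR wR' tt ww; kinds; fill [:: t; w'; s; t'; w] k.-1 Wf gW hW tW.
tight [:: t; w'; s; t'] Wf (@nil V) gW hW tW; tight [:: t; w'; w; t'] Wf (@nil V) gW hW tW; lra.
Qed.

Lemma move_R_before_R w w' s t : w \in Rs -> w' \in Rs -> s \in Si -> t \in Ts -> w != w' ->
  c w s + c t w' = c t w + c w w'.
Proof.
move=> wR wR' sS tT ww; kinds; fill [:: w; s; t; w'] k.-1 Wf gW hW tW.
tight [:: w; s; t; w'] Wf (@nil V) gW hW tW; tight [:: s; t; w; w'] Wf (@nil V) gW hW tW; lra.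
Qed.

Lemma move_R_before_S w s t s2 t2 : (1 < k)%N -> w \in Rs -> s \in Si -> t \in Ts ->
  s2 \in Si -> t2 \in Ts -> s != s2 -> t != t2 ->
  c w s + c t s2 = c t w + c w s2.
Proof.
move=> k1 wR sS tT s2S t2T ss tt; kinds; fill [:: w; s; t; s2; t2] k.-2 Wf gW hW tW.
tight [:: w; s; t; s2; t2] Wf (@nil V) gW hW tW; tight [:: s; t; w; s2; t2] Wf (@nil V) gW hW tW.
lra.
Qed.
Let Six s : s \in Si -> (s \in Si) || (s \in Ts). Proof. by move->. Qed.
Let Tx t : t \in Ts -> (t \in Si) || (t \in Ts). Proof. by move->; rewrite orbT. Qed.

Record block_state (B E eps : F) : Prop := BlockState {
  state_ST : forall s t, s \in Si -> t \in Ts -> c s t = B;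
  state_TT : forall t t', t \in Ts -> t' \in Ts -> t != t' -> c t t' = B;
  state_SS : forall s s', s \in Si -> s' \in Si -> s != s' -> c s s' = B;
  state_eT : forall t, t \in Ts -> e t = E;
  state_eS : forall s, s \in Si -> e s = eps;
  state_TS : forall t s, t \in Ts -> s \in Si -> c t s = B + E - eps;
  state_RS : forall w s, w \in Rs -> s \in Si -> c w s = B + e w - eps;
  state_RT : forall w t, w \in Rs -> t \in Ts -> c w t = B + e w - E
}.

Let T_gt1 : (1 < #|Ts|)%N. Proof. exact: leq_ltn_trans k_gt0 lt_k_T. Qed.
Let S_gt0 : (0 < #|Si|)%N. Proof. exact: leq_trans k_gt0 le_k_S. Qed.

Lemma block_state_gt1 : (1 < k)%N -> exists B E eps, block_state B E eps.
Proof.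
move=> k1; have T2 : (2 < #|Ts|)%N by apply: leq_trans lt_k_T.
have S1 : (1 < #|Si|)%N by apply: leq_trans le_k_S.
have /card_gt0P[s0 s0S] := S_gt0.
have /card_gt0P[t0 t0T] : (0 < #|Ts|)%N by apply: ltnW.
have e_ST s t t' : s \in Si -> t \in Ts -> t' \in Ts -> t != t' ->
    c s t + e t' = c t' s + e s.
  move=> sS tT tT' tt; have [s' sS' ss'] := exists_other s S1.
  by apply: (insert_end_T k1 sS tT tT' sS'); rewrite // eq_sym.
have indep s t t' : s \in Si -> t \in Ts -> t' \in Ts -> c s t = c s t'.
  move=> sS tT tT'; have [z [zT zt zt']] := exists_third t t' T2.
  have := e_ST _ _ _ sS tT zT; have := e_ST _ _ _ sS tT' zT.
  by rewrite ![_ == z]eq_sym => /(_ zt') ? /(_ zt) ?; lra.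
have ST s t : s \in Si -> t \in Ts -> c s t = c s0 t0.
  move=> sS tT; have [x xT xt] := exists_other t T_gt1.
  by rewrite (insert_front sS xT tT xt) -(insert_front s0S xT tT xt); apply: indep.
have TT t t' : t \in Ts -> t' \in Ts -> t != t' -> c t t' = c s0 t0.
  by move=> tT tT' tt; rewrite -(insert_front s0S tT tT' tt) ST.
have eT t : t \in Ts -> e t = e t0.
  move=> tT; have [-> //|tt] := eqVneq t t0.
  have [z [zT zt zt0]] := exists_third t t0 T2.
  have [t0z tz] : t0 != z /\ t != z by rewrite ![_ == z]eq_sym.
  have := insert_TS k1 (Tx t0T) tT s0S zT.
  rewrite eq_sym tt zt zt0 (_ : t0 != s0) => [/(_ isT isT isT isT)|]; last first.
    by apply: contraTneq s0S => <-; rewrite inner_SE (in_nodeT dRT dST S0 SN t0T).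
  have t0t : t0 != t by rewrite eq_sym.
  rewrite (TT t0 t) // (TT t t0) //.
  by have := e_ST _ _ _ s0S zT tT zt; have := e_ST _ _ _ s0S zT t0T zt0; rewrite (ST s0 z) //; lra.
have TS t s : t \in Ts -> s \in Si -> c t s = c s0 t0 + e t0 - e s.
  move=> tT sS; have [z zT zt] := exists_other t T_gt1.
  by have := e_ST _ _ _ sS zT tT zt; rewrite (ST s z) // (eT t) //; lra.
have eS s : s \in Si -> e s = e s0.
  move=> sS; have [-> //|ss] := eqVneq s s0.
  have [z zT zt] := exists_other t0 T_gt1.
  have := swap_S k1 sS s0S zT t0T ss zt.
  by rewrite (ST s z) // (ST s0 z) // (ST s t0) // (TS z s0) // (TS z s) //; lra.
exists (c s0 t0), (e t0), (e s0); split=> //.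
- move=> s s' sS sS' ss; have [z zT zt] := exists_other t0 T_gt1.
  have ne x : x \in Ts -> (x != s) * (s != x).
    by move=> xT; rewrite eq_sym; suff -> : s != x by []; apply: contraTneq sS => ->;
      rewrite inner_SE (in_nodeT dRT dST S0 SN xT).
  have := insert_TS k1 (Six sS) t0T sS' zT; rewrite (ne t0 t0T) (ne z zT) ss zt.
  move=> /(_ isT isT isT isT).
  by rewrite (ST s t0) // (TS t0 s) // (TS t0 s') // (eS s) // (eS s') //; lra.
- by move=> t s tT sS; rewrite (TS t s) // (eS s).
- move=> w s wR sS; have ne : s != t0.
    by apply: contraTneq sS => ->; rewrite inner_SE (in_nodeT dRT dST S0 SN t0T).
  by have := insert_end_R (Six sS) t0T wR ne; rewrite (ST s t0) // (eS s) //; lra.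
- move=> w t wR tT; have [z zT zt] := exists_other t T_gt1.
  have tz : t != z by rewrite eq_sym.
  by have := insert_end_R (Tx tT) zT wR tz; rewrite (TT t z) // (eT t) //; lra.
Qed.

Lemma block_state_eq1 : (1 < r)%N -> #|Si| = 1%N -> exists B E eps, block_state B E eps.
Proof.
move=> r1 /eqP/cards1P[s0 SiE].
have s0S : s0 \in Si by rewrite SiE set11.
have /card_gt0P[t0 t0T] : (0 < #|Ts|)%N by apply: ltnW.
have : (1 < #|Rs|)%N by rewrite rE.
move=> /card_gt1P[w0 [w1 [w0R w1R ww]]].
have ne t : t \in Ts -> s0 != t.
  by move=> tT; apply: contraTneq s0S => ->; rewrite inner_SE (in_nodeT dRT dST S0 SN tT).
have ST0 t : t \in Ts -> c s0 t = c s0 t0.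
  move=> tT; have := insert_end_R (Six s0S) tT w0R (ne _ tT).
  by have := insert_end_R (Six s0S) t0T w0R (ne _ t0T); lra.
have TT t t' : t \in Ts -> t' \in Ts -> t != t' -> c t t' = c s0 t0.
  by move=> tT tT' tt; rewrite -(insert_front s0S tT tT' tt) ST0.
have RT w t : w \in Rs -> t \in Ts -> c w t = c s0 t0 + e w - e t.
  move=> wR tT; have [z zT zt] := exists_other t T_gt1.
  have tz : t != z by rewrite eq_sym.
  by have := insert_end_R (Tx tT) zT wR tz; rewrite (TT t z) //; lra.
have RS w : w \in Rs -> c w s0 = c s0 t0 + e w - e s0.
  by move=> wR; have := insert_end_R (Six s0S) t0T wR (ne _ t0T); lra.
have SR : c s0 w1 = c w0 w1 - e w0 + e s0.
  by have := insert_RR (Six s0S) t0T w0R w1R (ne _ t0T) ww; rewrite (RS w0) //; lra.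
have TR t : t \in Ts -> c t w1 = c w0 w1 - e w0 + e t.
  move=> tT; have [z zT zt] := exists_other t T_gt1.
  have tz : t != z by rewrite eq_sym.
  by have := insert_RR (Tx tT) zT w0R w1R tz ww; rewrite (TT t z) // (RT w0 t) //; lra.
have eT t : t \in Ts -> e t = e t0.
  move=> tT; have [-> //|tt] := eqVneq t t0.
  have t0t : t0 != t by rewrite eq_sym.
  have := insert_TR (Tx tT) t0T w1R tt; rewrite (TT t t0) // (TT t0 t) // => tr.
  by have := TR _ tT; have := TR _ t0T; lra.
exists (c s0 t0), (e t0), (e s0); split=> //.
- by move=> s t; rewrite SiE inE => /eqP-> /ST0.
- by move=> s s'; rewrite SiE !inE => /eqP-> /eqP->; rewrite eqxx.
- by move=> s; rewrite SiE inE => /eqP->.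
- move=> t s tT; rewrite SiE inE => /eqP->.
  have := insert_TR (Six s0S) tT w1R (ne _ tT); rewrite (ST0 t) // (TR t) // SR (eT t) //.
  by lra.
- by move=> w s wR; rewrite SiE inE => /eqP->; apply: RS.
- by move=> w t wR tT; rewrite (RT w t) // (eT t).
Qed.

Lemma block_state_structure B E eps : block_state B E eps -> (1 < k)%N || (1 < r)%N ->
  (forall i j, internal i -> internal j -> i != j ->
     c i j = B + (E - eps) * ((i \notin Ss) && (j \notin Ts))%:R) /\
  (forall i, internal i -> e i = eps + (E - eps) * (i \notin Ss)%:R).
Proof.
case=> ST TT SS eT eS TS RS RT kr.
have /card_gt0P[s0 s0S] := S_gt0.
have /card_gt1P[t0 [t1 [t0T t1T tt]]] := T_gt1.
have TR t w : t \in Ts -> w \in Rs -> c t w = B + E - eps + E - e w.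
  move=> tT wR; have [z zT zt] := exists_other t T_gt1.
  have tz : t != z by rewrite eq_sym.
  by have := replace_TS tT s0S zT wR tz; rewrite (TS t s0) // (ST s0 z) // (RT w z) //; lra.
have SR s w : s \in Si -> w \in Rs -> c s w = B + E - e w.
  by move=> sS wR; have := replace_end t0T sS t1T wR tt; rewrite (ST s t1) // (eT t1) //; lra.
have RR w w' : w \in Rs -> w' \in Rs -> w != w' -> c w w' = B + E - eps + e w - e w'.
  move=> wR wR' ww; have ww' : w' != w by rewrite eq_sym.
  have := replace_RS t0T s0S t1T wR' wR tt ww'.
  by rewrite (ST s0 t1) // (RS w s0) // (RT w' t1) //; lra.
have eR w : w \in Rs -> e w = E.
  move=> wR; case/orP: kr => [k1|r1].
    have S1 : (1 < #|Si|)%N by apply: leq_trans le_k_S.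
    have [s1 s1S ss] := exists_other s0 S1.
    have := move_R_before_S k1 wR s1S t0T s0S t1T ss tt.
    by rewrite (RS w s1) // (RS w s0) // (TS t0 s0) // (TR t0 w) //; lra.
  have [|w' wR' ww] := @exists_other _ Rs w; first by rewrite rE.
  have := move_R_before_R wR wR' s0S t0T; rewrite eq_sym => /(_ ww).
  rewrite eq_sym in ww.
  by rewrite (RS w s0) // (TR t0 w') // (TR t0 w) // (RR w w') //; lra.
split=> [i j ii ij ne|i ii].
  have [iK|iK|iK] := kindP dRS dRT dST cover_RST S0 SN ii;
  have [jK|jK|jK] := kindP dRS dRT dST cover_RST S0 SN ij;
  rewrite ?iK ?jK /= ?(mulr1, mulr0, addr0).
  all: try have iS : i \in Si by rewrite inner_SE !iK.
  all: try have jS : j \in Si by rewrite inner_SE !jK.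
  all: try have iT : i \in Ts by rewrite !iK.
  all: try have jT : j \in Ts by rewrite !jK.
  all: try have iR : i \in Rs by rewrite !iK.
  all: try have jR : j \in Rs by rewrite !jK.
  - by rewrite (RR i j) // (eR i) // (eR j) //; lra.
  - by rewrite (RS i j) // (eR i) //; lra.
  - by rewrite (RT i j) // (eR i) //; lra.
  - by rewrite (SR i j) // (eR j) //; lra.
  - by rewrite SS.
  - by rewrite ST.
  - by rewrite (TR i j) // (eR j) //; lra.
  - by rewrite (TS i j) //; lra.
  - by rewrite TT.
have [iK|iK|iK] := kindP dRS dRT dST cover_RST S0 SN ii; rewrite ?iK /= ?(mulr1, mulr0, addr0).
- by rewrite eR ?iK //; lra.
- by rewrite eS // inner_SE !iK.
- by rewrite eT ?iK //; lra.
Qed.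

Lemma cost_affine (B eps lam : F) :
  (forall i j, internal i -> internal j -> i != j ->
     c i j = B + lam * ((i \notin Ss) && (j \notin Ts))%:R) ->
  (forall i, internal i -> e i = eps + lam * (i \notin Ss)%:R) ->
  forall W, word p W ->
  cost c ord0 (rcons W N) = (p - 2)%:R * B + eps + lam * (gmcw (ord0 :: W))%:R.
Proof.
move=> cE eE.
have aux x W : uniq (x :: W) -> all internal (x :: W) ->
    cost c x (rcons W N) = (size W)%:R * B + eps + lam * ((x \in Ts) + gmcw (x :: W))%:R.
  elim: W x => [|y W IH] x.
    rewrite /= andbT => _ ix; rewrite eE // (ord_max_notin_T dST SN) andbF
      addr0 mul0r add0r addn0 addn0.
    have [xK|xK|xK] := kindP dRS dRT dST cover_RST S0 SN ix; by rewrite !xK.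
  move=> /= /and3P[]; rewrite inE negb_or => /andP[xy xW] yW uW /and3P[ix iy iW].
  rewrite cE // IH /= ?yW ?uW ?iy //.
  have [xK|xK|xK] := kindP dRS dRT dST cover_RST S0 SN ix;
  have [yK|yK|yK] := kindP dRS dRT dST cover_RST S0 SN iy;
  rewrite !xK !yK /= ?(add0n, addn0) !natrD ?natr1 -?natr1; lra.
move=> [|x W] /and3P[/eqP sW uW iW].
  by move: sW pE k_gt0 => /=; clear; lia.
have ix : internal x by case/andP: iW.
have -> : gmcw (ord0 :: x :: W) = ((x \in Ts) + gmcw (x :: W))%N.
  by rewrite [LHS]/= (ord0_notin_R dRS S0) S0.
rewrite [LHS]/= c0 add0r aux //; congr (_ * _ + _ + _).
by congr (_%:R); move: sW => /=; clear; lia.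
Qed.

End Exchange.

(** * The path polytope *)

Section PathPolytope.
Variables (F : realFieldType) (n p : nat) (Rs Ss Ts : {set 'I_n.+1}).
Notation V := 'I_n.+1.
Notation N := (@ord_max n).
Hypothesis n_gt0 : (0 < n)%N.
Hypothesis p_ge4 : (4 <= p)%N.
Hypothesis p_le : (p <= n - 1)%N.
Hypothesis dRS : [disjoint Rs & Ss].
Hypothesis dRT : [disjoint Rs & Ts].
Hypothesis dST : [disjoint Ss & Ts].
Hypothesis cover_RST : Rs :|: Ss :|: Ts = [set: V].
Hypothesis S0 : ord0 \in Ss.
Hypothesis SN : N \in Ss.
Notation nodeR := (nodeR Rs Ss Ts).
Notation nodeS := (nodeS Rs Ss Ts).
Notation nodeT := (nodeT Rs Ss Ts).
Notation gmcw := (gmcw Rs Ss Ts).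
Notation Si := (inner_S Ss).
Implicit Types (W : seq V) (C : V -> V -> F).

Let p_gt1 : (1 < p)%N. Proof. exact: leq_trans p_ge4. Qed.

Definition arcs_of W := zip (ord0 :: rcons W N) (rcons W N).

Lemma uniq_word_path W : word p W -> uniq (ord0 :: rcons W N).
Proof.
move=> wW; have /(ppath_word _ n_gt0 p_gt1) : exists2 W', rcons W N = rcons W' N & word p W'.
  by exists W.
by case/and4P.
Qed.

Let bound := (p + #|Rs|)./2.
Definition tight_word W := word p W && (gmcw (ord0 :: W) == bound).

Let I := {t : p.-tuple V | ppath n p t}.
Let v (i : I) : arc n -> F := incid F n (val i).
Let X y := exists t, ppath n p t /\ y = incid F n t.
Let l (a : arc n) : F := (tl a == ord0)%:R.
Let h (a : arc n) : F := (gmc Rs Ss Ts (tl a) (hd a))%:R.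

Let XE y : X y <-> exists i, y = v i.
Proof.
split=> [[t [pt ->]]|[i ->]]; last by exists (val i); split=> //; apply: (valP i).
have st : size t == p by case/and4P: pt.
by exists (exist (fun t : p.-tuple V => ppath n p t) (Tuple st) pt).
Qed.

Lemma gmc_lhs_dot y : gmc_lhs Rs Ss Ts y = dot h y.
Proof.
rewrite /gmc_lhs /dot
  (_ : \sum_(i in Rs) _ = \sum_(a : arc n | tl a \in Rs) y a); last first.
  rewrite (exchange_big_dep (fun a : arc n => tl a \in Rs)) /=; last by move=> i a iR /eqP->.
  apply: eq_bigr => a aR; rewrite (big_pred1 (tl a)) // => i.
  by apply/andP/eqP => [[_ /eqP]|->].
rewrite big_mkcond [X in _ + X]big_mkcond -big_split /=; apply: eq_bigr => a _.
rewrite /h /gmc; case: (boolP (tl a \in Rs)) => [aR|_].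
  by rewrite (disjointFr dRS aR) /= add0r mul1r.
by case: ifP; rewrite /= ?mul1r ?mul0r addr0.
Qed.

Lemma incid_of W : word p W -> exists i, v i = incid F n (rcons W N).
Proof.
move=> wW; have /XE[i ->] : X (incid F n (rcons W N)); last by exists i.
by exists (rcons W N); split=> //; apply/ppath_word => //; exists W.
Qed.

Lemma word_of i : exists2 W, word p W & v i = incid F n (rcons W N).
Proof.
have /(ppath_word _ n_gt0 p_gt1)[W iW wW] := valP i.
by exists W => //; rewrite /v iW.
Qed.

Lemma dot_word C W : word p W ->
  dot (fun a => C (tl a) (hd a)) (incid F n (rcons W N)) = cost C ord0 (rcons W N).
Proof. by move=> wW; apply: (@dot_incid_restrict _ _ _ p); apply/ppath_word => //; exists W. Qed.

Lemma dot_ext_word c W : word p W ->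
  dot c (incid F n (rcons W N)) = cost (extend c) ord0 (rcons W N).
Proof. by move=> wW; apply: (@dot_incid _ _ _ p); apply/ppath_word => //; exists W. Qed.

Lemma cost_gmc W : cost (fun i j => (gmc Rs Ss Ts i j)%:R) ord0 (rcons W N) =
  (gmcw (ord0 :: W))%:R :> F.
Proof. by rewrite cost_count gmcwE. Qed.

Lemma cost_visit x w W : uniq (x :: W) ->
  cost (fun i _ => (i == w)%:R : F) x (rcons W N) = (w \in x :: W)%:R.
Proof.
elim: W x => [|y W IH] x /=; first by rewrite addr0 inE eq_sym.
move=> /andP[xW uW]; rewrite IH // [in RHS]in_cons [w == x]eq_sym; case: eqP => [<-|_] /=.
  by rewrite (negPf xW) addr0.
by rewrite add0r.
Qed.

Lemma cost_arc e W : word p W ->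
  cost (fun i j => ((i, j) == e)%:R : F) ord0 (rcons W N) = (e \in arcs_of W)%:R.
Proof.
move=> wW; rewrite cost_count -/(arcs_of W) -(count_uniq_mem e).
  by congr (_%:R); apply: eq_count => a; rewrite -surjective_pairing.
by apply: zip_uniql; apply: uniq_word_path.
Qed.

Lemma cost_sub C D x s : cost (fun i j => C i j - D i j) x s = cost C x s - cost D x s.
Proof. by elim: s x => [|y s IH] x /=; rewrite ?subr0 // IH; ring. Qed.

Lemma cost_scale b C x s : cost (fun i j => b * C i j) x s = b * cost C x s.
Proof. by elim: s x => [|y s IH] x /=; rewrite ?mulr0 // IH; ring. Qed.

Lemma word_uniq0 W : word p W -> uniq (ord0 :: W).
Proof.
case/and3P=> _ /= -> /allP iW; rewrite andbT; apply/negP => /iW.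
by rewrite /internal eqxx.
Qed.

Lemma count_arc_class W : all internal W ->
  let q := count (fun e => (e.1 \in Ss) && (e.2 \in Ts)) (arcs_of W) in
  let a := count (fun e => (e.1 \notin Ss) && (e.2 \in Ts)) (arcs_of W) in
  let b := count (fun e => (e.1 \in Ss) && (e.2 \notin Ts)) (arcs_of W) in
  [/\ gmcw (ord0 :: W) = count (mem Rs) W + q, q + a = count (mem Ts) W,
      q + b = (count (mem Ss) W).+1 &
      count (mem Rs) W + count (mem Ss) W + count (mem Ts) W = size W]%N.
Proof.
move=> iW q a b; rewrite {}/q {}/a {}/b /arcs_of; split.
- suff H x : gmcw (x :: W) = (count (mem Rs) (x :: W) +
      count (fun e => (e.1 \in Ss) && (e.2 \in Ts)) (zip (x :: rcons W N) (rcons W N)))%N.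
    by rewrite H /= (ord0_notin_R dRS S0).
  elim: W x {iW} => [|y W IH] x /=; first by rewrite (ord_max_notin_T dST SN) andbF !addn0.
  move: (IH y) => /= ->; rewrite !addnA; congr (_ + _)%N.
  by rewrite -!addnA; congr (_ + _)%N; rewrite addnC -!addnA.
- suff H x : (count (fun e => (e.1 \in Ss) && (e.2 \in Ts)) (zip (x :: rcons W N) (rcons W N)) +
    count (fun e => (e.1 \notin Ss) && (e.2 \in Ts)) (zip (x :: rcons W N) (rcons W N)))%N =
    count (mem Ts) W by apply: H.
  elim: W x {iW} => [|y W IH] x /=; first by rewrite (ord_max_notin_T dST SN) !andbF.
  by move: (IH y) => /=; case: (x \in Ss); case: (y \in Ts); clear => /=; lia.
- suff H x : (count (fun e => (e.1 \in Ss) && (e.2 \in Ts)) (zip (x :: rcons W N) (rcons W N)) +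
    count (fun e => (e.1 \in Ss) && (e.2 \notin Ts)) (zip (x :: rcons W N) (rcons W N)))%N =
    count (mem Ss) (x :: W) by rewrite H /= S0.
  elim: W x {iW} => [|y W IH] x /=.
    by rewrite (ord_max_notin_T dST SN) !andbT !andbF /= addn0.
  by move: (IH y) => /=; case: (x \in Ss); case: (y \in Ts); clear => /=; lia.
elim: W iW => //= x W IH /andP[ix /IH <-].
by have [xK|xK|xK] := kindP dRS dRT dST cover_RST S0 SN ix; rewrite !xK; clear; lia.
Qed.

Lemma count_mem_all (A : {set V}) W x : uniq W -> count (mem A) W = #|A| -> x \in A -> x \in W.
Proof.
move=> uW cA xA; apply: contraT => xW.
have cW : count (mem (A :\ x)) W = #|A|.
  rewrite -cA; apply: eq_in_count => y yW /=; rewrite !inE.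
  by case: eqP => //= yx; rewrite -yx yW in xW.
by have := count_mem_le (A :\ x) uW; rewrite cW (cardsD1 x A) xA ltnn.
Qed.

Lemma count_inner_S W : all internal W -> count (mem Ss) W = count (mem Si) W.
Proof.
by move=> /allP iW; apply: eq_in_count => x /iW ix; rewrite /= inner_SE ix andbT.
Qed.

(* rho nodes of R visited, sg internal nodes of S visited; q arcs in (S:T), a arcs
   in (V\S:T), b arcs in (S:V\T). *)
Record word_census W (rho q a b sg : nat) : Prop := WordCensus {
  census_gmc : gmcw (ord0 :: W) = (rho + q)%N;
  census_T : (q + a <= #|Ts|)%N;
  census_Seq : (q + b = sg.+1)%N;
  census_S : (sg <= #|Si|)%N;
  census_R : (rho <= #|Rs|)%N;
  census_size : p = (rho + 2 * q + a + b)%N;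
  census_visit : rho = #|Rs| -> forall w, w \in Rs -> w \in W;
  census_a : a = 0%N -> forall i j, i \notin Ss -> j \in Ts -> (i, j) \notin arcs_of W;
  census_b : b = 0%N -> forall i j, i \in Ss -> j \notin Ts -> (i, j) \notin arcs_of W;
  census_2S : (sg < 2)%N -> forall i j, i \in Si -> j \in Si -> i != j -> i \in W -> j \notin W
}.

Lemma censusP W : word p W -> exists rho q a b sg, word_census W rho q a b sg.
Proof.
case/and3P=> /eqP sW uW iW; have := count_arc_class iW.
set q := count _ (arcs_of W); set a := count _ (arcs_of W); set b := count _ (arcs_of W).
move=> /= [gE Te Se sz].
exists (count (mem Rs) W), q, a, b, (count (mem Ss) W); split=> //.
- by rewrite Te count_mem_le.
- by rewrite count_inner_S // count_mem_le.
- by rewrite count_mem_le.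
- have total (r s t q' a' b' z : nat) : z = p.-1 -> (r + s + t = z)%N -> (q' + a' = t)%N ->
      (q' + b' = s.+1)%N -> p = (r + 2 * q' + a' + b')%N.
    by move: p_ge4; clear; lia.
  exact: total sW sz Te Se.
- by move=> cR w; apply: count_mem_all.
- move=> a0 i j iS jT; apply/negP => ij.
  have : has (fun e => (e.1 \notin Ss) && (e.2 \in Ts)) (arcs_of W).
    by apply/hasP; exists (i, j) => //=; rewrite iS.
  by rewrite has_count -/a a0.
- move=> b0 i j iS jT; apply/negP => ij.
  have : has (fun e => (e.1 \in Ss) && (e.2 \notin Ts)) (arcs_of W).
    by apply/hasP; exists (i, j) => //=; rewrite iS.
  by rewrite has_count -/b b0.
move=> lt2 i j iS jS ij iW'; apply/negP => jW.
suff : (2 <= count (mem Ss) W)%N by rewrite leqNgt lt2.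
rewrite -size_filter; apply: (@leq_trans (size [:: i; j])) => //.
apply: uniq_leq_size; first by rewrite /= inE ij.
move: iS jS; rewrite !inner_SE => /andP[iS _] /andP[jS _] x.
by rewrite !inE mem_filter => /orP[]/eqP->; rewrite /= ?iS ?jS.
Qed.

Lemma gmcw_le W : word p W -> (gmcw (ord0 :: W) <= bound)%N.
Proof.
move=> /censusP[rho [q [a [b [sg cW]]]]].
have := census_gmc cW; have := census_size cW; have := census_R cW.
by rewrite /bound; move: (gmcw _) #|Rs|; clear; lia.
Qed.

Let dot_l i : dot l (v i) = 1.
Proof.
have [W wW ->] := word_of i; rewrite (dot_word (fun i _ => (i == ord0)%:R) wW).
by rewrite cost_visit ?word_uniq0 // inE eqxx.
Qed.

Let dot_h W : word p W -> dot h (incid F n (rcons W N)) = (gmcw (ord0 :: W))%:R.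
Proof.
by move=> wW; rewrite (dot_word (fun i j => (gmc Rs Ss Ts i j)%:R) wW) cost_gmc.
Qed.

Let dot_h_le i : dot h (v i) <= bound%:R.
Proof. by have [W wW ->] := word_of i; rewrite dot_h // ler_nat gmcw_le. Qed.

Lemma gmc_valid : valid_ineq (Ppath F n p) (gmc_lhs Rs Ss Ts) bound%:R.
Proof. exact: conv_valid XE gmc_lhs_dot dot_l dot_h_le. Qed.

Notation facet := (facet_defining (Ppath F n p) (gmc_lhs Rs Ss Ts) bound%:R).

Lemma not_facet_words C1 C2 W1 W2 : word p W1 -> word p W2 ->
  (forall W, tight_word W -> cost C1 ord0 (rcons W N) = 0) ->
  (forall W, tight_word W -> cost C2 ord0 (rcons W N) = 0) ->
  cost C1 ord0 (rcons W1 N) != 0 -> cost C2 ord0 (rcons W1 N) = 0 ->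
  cost C2 ord0 (rcons W2 N) != 0 -> ~ facet.
Proof.
move=> w1 w2 z1 z2 n11 z21 n22.
have [i1 v1] := incid_of w1; have [i2 v2] := incid_of w2.
have z C : (forall W, tight_word W -> cost C ord0 (rcons W N) = 0) ->
    forall i, dot h (v i) == bound%:R -> dot (fun a => C (tl a) (hd a)) (v i) = 0.
  move=> zC i; have [W wW ->] := word_of i.
  by rewrite dot_h // eqr_nat dot_word // => tW; apply: zC; rewrite /tight_word wW.
apply: (not_facet XE gmc_lhs_dot dot_l dot_h_le (i1 := i1) (i2 := i2) (z _ z1) (z _ z2));
  by rewrite ?v1 ?v2 dot_word.
Qed.

Lemma facet_words W0 : word p W0 -> gmcw (ord0 :: W0) != bound ->
  (forall C, C ord0 ord0 = 0 -> C ord0 N = 0 ->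
   (forall W, tight_word W -> cost C ord0 (rcons W N) = 0) ->
   exists lam, forall W, word p W ->
     cost C ord0 (rcons W N) = lam * ((gmcw (ord0 :: W))%:R - bound%:R)) ->
  facet.
Proof.
move=> w0 nt0 HC; have [i0 v0] := incid_of w0.
apply: (facet_sufficient XE gmc_lhs_dot dot_l dot_h_le (i0 := i0)).
  by rewrite v0 dot_h // eqr_nat.
move=> c zc; have ext0 (x : V) : ~~ arcb n (ord0, x) -> extend c ord0 x = 0.
  by move=> nx; rewrite /extend insubN.
have [|||lam lamE] := HC (extend c).
- by apply: ext0; rewrite /arcb eqxx.
- by apply: ext0; rewrite /arcb !eqxx !andbF.
  move=> W /andP[wW gW]; rewrite -dot_ext_word //.
  by have [i vi] := incid_of wW; rewrite -vi zc // vi dot_h // eqr_nat.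
by exists lam => i; have [W wW ->] := word_of i; rewrite dot_ext_word // dot_h // lamE.
Qed.
Lemma card_internal : #|[set x : V | internal x]| = n.-1.
Proof.
have := cardsC [set ord0; N]; rewrite card_ord cards2 [ord0 == _]eq_sym (N_neq0 n_gt0) /=.
rewrite (_ : ~: _ = [set x | internal x]) => [|]; last first.
  by apply/setP => x; rewrite !inE negb_or.
by move: #|_| => m; move: n_gt0; clear; lia.
Qed.

Lemma extend_word L w : uniq L -> all internal L -> (size L <= p.-1)%N ->
  exists Wf : seq V,
    [/\ size Wf = (p.-1 - size L)%N, w \notin Wf, word p (L ++ Wf) & word p (Wf ++ L)].
Proof.
move=> uL iL sL; pose A := [set x : V | internal x] :\ w.
pose Wf := take (p.-1 - size L) [seq x <- enum A | x \notin L].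
have sA : (p.-1 <= #|A|)%N.
  have := cardsD1 w [set x : V | internal x]; rewrite card_internal -/A.
  by move: #|A| (w \in _) => m b; move: p_le p_ge4; clear; case: b => /=; lia.
have sW : size Wf = (p.-1 - size L)%N.
  rewrite size_takel // size_filter_notin //; apply: leq_sub => //.
  exact: count_size.
have memW x : x \in Wf -> [/\ x != w, internal x & x \notin L].
  by move/mem_take; rewrite mem_filter mem_enum !inE => /and3P[].
have uW : uniq Wf by apply/take_uniq/filter_uniq/enum_uniq.
have wLW : word p (L ++ Wf).
  rewrite /word size_cat sW subnKC // eqxx cat_uniq uL uW andbT.
  rewrite all_cat iL /=; apply/andP; split.
    by apply/hasPn => x /memW[].
  by apply/allP => x /memW[].
exists Wf; split=> //; first by apply/negP => /memW[]; rewrite eqxx.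
by move: wLW; rewrite /word !size_cat addnC uniq_catC !all_cat [all _ L && _]andbC.
Qed.

Lemma arcs_of_cat L x y W : (x, y) \in arcs_of (L ++ x :: y :: W).
Proof.
rewrite /arcs_of; elim: L (ord0) => [|z L IH] u /=; last by rewrite inE IH orbT.
by rewrite !inE eqxx !orbT.
Qed.

Lemma arcs_of_first x W : (ord0, x) \in arcs_of (x :: W).
Proof. by rewrite /arcs_of /= inE eqxx. Qed.

Lemma arcs_of_last W x : (x, N) \in arcs_of (rcons W x).
Proof.
rewrite /arcs_of -!cats1 -catA /=; elim: W (ord0) => [|z W IH] u /=; last by rewrite inE IH orbT.
by rewrite !inE eqxx orbT.
Qed.

Lemma arcs_of_mem W i j : word p W -> (i, j) \in arcs_of W -> i \in ord0 :: W /\ j \in rcons W N.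
Proof.
move=> wW ij; have := uniq_word_path wW; rewrite -rcons_cons rcons_uniq => /andP[NW _].
have key x U : N \notin x :: U -> (N, j) \notin zip (x :: rcons U N) (rcons U N).
  elim: U x => [|y U IH] x /=; first by rewrite !inE xpair_eqE => /negPf->.
  by rewrite inE negb_or => /andP[/negPf Nx NU]; rewrite inE xpair_eqE Nx; apply: IH.
have /andP[] := mem_zip2 ij; rewrite -rcons_cons mem_rcons inE => /orP[/eqP iN|//] jW.
by move: ij; rewrite iN /arcs_of (negPf (key _ _ NW)).
Qed.

Lemma arc_unique_next W i j j' : word p W ->
  (i, j) \in arcs_of W -> (i, j') \in arcs_of W -> j = j'.
Proof.
move=> wW; have := uniq_word_path wW; rewrite /arcs_of.
elim: (rcons W N) (ord0) => [|y s IH] x //= /andP[xs us].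
rewrite !inE !xpair_eqE => /orP[/andP[/eqP ix /eqP jy]|ij] /orP[/andP[/eqP ix' /eqP jy']|ij'].
- by rewrite jy jy'.
- by have /andP[] := mem_zip2 ij'; rewrite ix (negPf xs).
- by have /andP[] := mem_zip2 ij; rewrite ix' (negPf xs).
exact: IH us ij ij'.
Qed.
Let p1_ge2 : (2 <= p.-1)%N. Proof. by move: p_ge4; clear; lia. Qed.
Let p1_ge1 : (1 <= p.-1)%N. Proof. exact: ltnW p1_ge2. Qed.
Let natr_neq0 (b : bool) : b -> b%:R != 0 :> F. Proof. by move->; apply: oner_neq0. Qed.

Lemma not_facet_arcs e f W1 W2 : word p W1 -> word p W2 ->
  (forall W, tight_word W -> e \notin arcs_of W) ->
  (forall W, tight_word W -> f \notin arcs_of W) ->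
  e \in arcs_of W1 -> f \notin arcs_of W1 -> f \in arcs_of W2 -> ~ facet.
Proof.
move=> w1 w2 ze zf eW1 fW1 fW2.
pose C (a : V * V) i j : F := ((i, j) == a)%:R.
have z a : (forall W, tight_word W -> a \notin arcs_of W) ->
    forall W, tight_word W -> cost (C a) ord0 (rcons W N) = 0.
  by move=> za W tW; have /andP[wW _] := tW; rewrite cost_arc // (negPf (za W tW)).
apply: (not_facet_words w1 w2 (z e ze) (z f zf)); rewrite cost_arc ?natr_neq0 //.
by rewrite (negPf fW1).
Qed.

Lemma cost_miss w W : w != ord0 -> word p W ->
  cost (fun i _ => (i == ord0)%:R - (i == w)%:R : F) ord0 (rcons W N) = (w \notin W)%:R.
Proof.
move=> w0 wW; rewrite cost_sub !cost_visit ?(word_uniq0 wW) // !inE eqxx (negPf w0) /=.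
by case: (w \in W); rewrite /= ?subrr ?subr0.
Qed.

Lemma not_facet_R_arc w e W1 : w \in Rs -> word p W1 ->
  (forall W, tight_word W -> w \in W) -> (forall W, tight_word W -> e \notin arcs_of W) ->
  e \in arcs_of W1 -> w \in W1 -> ~ facet.
Proof.
move=> wR w1 zw ze eW1 wW1; have w0 : w != ord0.
  by apply: contraTneq wR => ->; rewrite (ord0_notin_R dRS S0).
have [W2 [_ wW2 w2 _]] := @extend_word [::] w isT isT (leq0n _).
pose C1 i j : F := ((i, j) == e)%:R.
pose C2 (i j : V) : F := (i == ord0)%:R - (i == w)%:R.
have z1 W : tight_word W -> cost C1 ord0 (rcons W N) = 0.
  by move=> tW; have /andP[wW _] := tW; rewrite cost_arc // (negPf (ze W tW)).
have z2 W : tight_word W -> cost C2 ord0 (rcons W N) = 0.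
  by move=> tW; have /andP[wW _] := tW; rewrite cost_miss // zw.
apply: (not_facet_words w1 w2 z1 z2).
- by rewrite cost_arc // natr_neq0.
- by rewrite cost_miss // wW1.
- by rewrite cost_miss // natr_neq0.
Qed.

Lemma not_facet_RR w1 w2 : w1 \in Rs -> w2 \in Rs -> w1 != w2 ->
  (forall W, tight_word W -> forall w, w \in Rs -> w \in W) -> ~ facet.
Proof.
move=> w1R w2R ww zw; have n0 w : w \in Rs -> w != ord0.
  by move=> wR; apply: contraTneq wR => ->; rewrite (ord0_notin_R dRS S0).
have i2 := in_nodeR dRS dRT S0 SN w2R.
have i2s : all internal [:: w2] by rewrite /= i2.
have [Wf [_ w1Wf wW1 _]] := @extend_word [:: w2] w1 isT i2s p1_ge1.
have [W2 [_ wW2 w22 _]] := @extend_word [::] w2 isT isT (leq0n _).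
pose C w (i j : V) : F := (i == ord0)%:R - (i == w)%:R.
have z w : w \in Rs -> forall W, tight_word W -> cost (C w) ord0 (rcons W N) = 0.
  by move=> wR W tW; have /andP[wW _] := tW; rewrite cost_miss ?n0 // zw.
apply: (not_facet_words wW1 w22 (z _ w1R) (z _ w2R)); rewrite cost_miss ?n0 //.
- by rewrite natr_neq0 // inE negb_or ww.
- by rewrite inE eqxx.
- by rewrite natr_neq0.
Qed.

Lemma not_facet_first_last s : internal s ->
  (forall W, tight_word W -> (ord0, s) \notin arcs_of W) ->
  (forall W, tight_word W -> (s, N) \notin arcs_of W) -> ~ facet.
Proof.
move=> si z1 z2; have si1 : all internal [:: s] by rewrite /= si.
have [Wf [sWf _ w1 w2]] := @extend_word [:: s] s isT si1 p1_ge1.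
rewrite cats1 in w2; have := arcs_of_first s Wf; have := arcs_of_last Wf s.
move=> fW2 eW1; apply: (not_facet_arcs w1 w2 z1 z2) => //.
case: Wf sWf w1 {w2 fW2 eW1} => [|y Wf] sWf w1; first by move: p_ge4 sWf; clear => /=; lia.
apply/negP => sN; have yN := arc_unique_next w1 sN (arcs_of_cat [::] s y Wf).
by case/and3P: w1 => _ _ /=; rewrite -yN /internal eqxx andbF /= andbF.
Qed.

Lemma not_facet_opposite i j : internal i -> internal j -> i != j ->
  (forall W, tight_word W -> (i, j) \notin arcs_of W) ->
  (forall W, tight_word W -> (j, i) \notin arcs_of W) -> ~ facet.
Proof.
move=> ii ij ne z1 z2.
have ext (x y : V) : internal x -> internal y -> x != y -> exists Wf, word p (x :: y :: Wf).
  move=> ix iy xy; have uxy : uniq [:: x; y] by rewrite /= inE xy.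
  have ixy : all internal [:: x; y] by rewrite /= ix iy.
  by have [Wf [_ _ w1 _]] := extend_word x uxy ixy p1_ge2; exists Wf.
have [W1 w1] := ext i j ii ij ne; have [|W2 w2] := ext j i ij ii; first by rewrite eq_sym.
apply: (not_facet_arcs w1 w2 z1 z2 (arcs_of_cat [::] i j W1) _ (arcs_of_cat [::] j i W2)).
have := uniq_word_path w1; rewrite /arcs_of /= => /and3P[_ iW _].
move: iW; rewrite inE negb_or => /andP[_ iW].
have /andP[/negPf j0 _] := ij.
rewrite !inE !xpair_eqE j0 [j == i]eq_sym (negPf ne) /=.
by apply/negP => /mem_zip2/andP[_]; rewrite (negPf iW).
Qed.

Lemma not_facet_common_head w1 w2 t : internal w1 -> internal w2 -> internal t ->
  w1 != w2 -> w1 != t -> w2 != t ->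
  (forall W, tight_word W -> (w1, t) \notin arcs_of W) ->
  (forall W, tight_word W -> (w2, t) \notin arcs_of W) -> ~ facet.
Proof.
move=> i1 i2 it n12 n1t n2t z1 z2.
have ext (x : V) : internal x -> x != t -> exists Wf, word p (x :: t :: Wf).
  move=> ix xt; have uxt : uniq [:: x; t] by rewrite /= inE xt.
  have ixt : all internal [:: x; t] by rewrite /= ix it.
  by have [Wf [_ _ wW _]] := extend_word x uxt ixt p1_ge2; exists Wf.
have [W1 wW1] := ext _ i1 n1t; have [W2 wW2] := ext _ i2 n2t.
apply: (not_facet_arcs wW1 wW2 z1 z2 (arcs_of_cat [::] w1 t W1) _ (arcs_of_cat [::] w2 t W2)).
have := uniq_word_path wW1; rewrite /arcs_of /= => /and4P[_ _ tW _].
rewrite !inE !xpair_eqE [t == w1]eq_sym (negPf n1t) [w2 == w1]eq_sym (negPf n12) andbF /=.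
by apply/negP => /mem_zip2/andP[_]; rewrite (negPf tW).
Qed.
Lemma not_facet_small : p = 4 -> #|Rs| = 1%N -> #|Si| = 1%N -> (1 < #|Ts|)%N -> ~ facet.
Proof.
move=> p4 /eqP/cards1P[w RE] /eqP/cards1P[s SE] /card_gt1P[t1 [t2 [t1T t2T tt]]].
have wK : nodeR w by apply: (in_nodeR dRS dRT S0 SN); rewrite RE set11.
have sK : nodeS s by apply: (in_inner_S dRS dST); rewrite SE set11.
have boundE : bound = 2%N by rewrite /bound p4 RE cards1.
have inE3 x : internal x -> [\/ x = w, x = s | x \in Ts].
  move=> ix; case: (kindP dRS dRT dST cover_RST S0 SN ix) => xK; last by apply: Or33; rewrite xK.
    by have := xK.1.1.1; rewrite RE inE => /eqP; apply: Or31.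
  by have : x \in Si; [rewrite inner_SE !xK | rewrite SE inE => /eqP; apply: Or32].
have neT x : x \in Ts -> ((x == w) = false) * ((x == s) = false).
  move=> xT; split; apply: contraTF xT => /eqP->; first by rewrite wK.
  by rewrite sK.
have ws : (w == s) = false by apply/negbTE/eqP => E; have := wK.1.1.1; rewrite E sK.
have n0 x : internal x -> ((ord0 == x) = false) * ((N == x) = false) * ((x == N) = false)
    * ((x == ord0) = false).
  by rewrite ![_ == x]eq_sym => /andP[/negPf-> /negPf->].
have [nw ns] := (n0 w wK.2, n0 s sK.2).
pose C1 i j : F := (gmc Rs Ss Ts i j)%:R - 2 * (i == ord0)%:R.
(* Besides the inequality itself, x_ws = x_0w + x_sn holds on tight paths. *)
pose C2 i j : F := ((i == w) && (j == s))%:R - ((i == ord0) && (j == w))%:R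
  - ((i == s) && (j == N))%:R.
have cost1 W : word p W -> cost C1 ord0 (rcons W N) = (gmcw (ord0 :: W))%:R - 2.
  by move=> wW; rewrite cost_sub cost_scale cost_gmc cost_visit ?(word_uniq0 wW) // inE eqxx mulr1.
have wordt x y z : internal x -> internal y -> internal z -> uniq [:: x; y; z] ->
    word p [:: x; y; z].
  by move=> ix iy iz u; rewrite /word u p4 /= ix iy iz.
have t1K := in_nodeT dRT dST S0 SN t1T; have t2K := in_nodeT dRT dST S0 SN t2T.
have [nt1 nt2] := (n0 t1 t1K.2, n0 t2 t2K.2).
have W1 : word p [:: s; t1; t2].
  apply: wordt; rewrite ?t1K ?t2K ?sK //=.
  by rewrite !inE negb_or tt ![s == _]eq_sym !neT.
have W2 : word p [:: t1; t2; s].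
  by apply: wordt; rewrite ?t1K ?t2K ?sK //= !inE negb_or tt !neT.
apply: (@not_facet_words C1 C2 _ _ W1 W2).
- by move=> W /andP[wW /eqP gW]; rewrite cost1 // gW boundE subrr.
- case=> [|x [|y [|z [|? ?]]]] /andP[/and3P[/eqP]]; rewrite p4 //= => _.
  rewrite !inE !negb_or !andbT => /andP[/andP[xy xz] yz] /and3P[ix iy iz].
  rewrite boundE /C2 (ord0_notin_R dRS S0) S0 (ord_max_notin_T dST SN) /=.
  have nx := n0 x ix; have ny := n0 y iy; have nz := n0 z iz.
  have [xE|xE|xE] := inE3 x ix; have [yE|yE|yE] := inE3 y iy; have [zE|zE|zE] := inE3 z iz;
  move: xy xz yz nx ny nz; rewrite ?xE ?yE ?zE ?eqxx //= => xy xz yz nx ny nz;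
  rewrite ?nw ?ns ?nx ?ny ?nz ?wK ?sK ?(neT _ xE) ?(neT _ yE) ?(neT _ zE)
    ?(in_nodeT dRT dST S0 SN xE) ?(in_nodeT dRT dST S0 SN yE) ?(in_nodeT dRT dST S0 SN zE)
    ?[s == w]eq_sym ?ws ?eqxx //= => _; ring.
- rewrite cost1 // /= (ord0_notin_R dRS S0) S0 (ord_max_notin_T dST SN) !sK !t1K !t2K /= subr_eq0.
  by rewrite eqr_nat.
- rewrite /C2 /= !ns !nw !nt1 !nt2 !(neT _ t1T) !(neT _ t2T) [s == w]eq_sym ws !eqxx /=.
  by rewrite !subr0 !add0r.
rewrite /C2 /= !ns !nw !nt1 !nt2 !(neT _ t1T) !(neT _ t2T) [s == w]eq_sym ws !eqxx /=.
by rewrite !(subr0, add0r, addr0) oppr_eq0 oner_neq0.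
Qed.
Ltac nat_arith :=
  repeat match goal with
  | K : is_true (leq _ _) |- _ => revert K
  | K : is_true (odd _) |- _ => revert K
  | K : is_true (~~ odd _) |- _ => revert K
  | K : @eq nat _ _ |- _ => revert K
  end; clear; lia.

Lemma card_partition : (#|Rs| + #|Si| + #|Ts| + 1 = n)%N.
Proof.
have cS := card_inner_S n_gt0 S0 SN.
have := cardsT V; rewrite card_ord -cover_RST.
rewrite cardsU (_ : (Rs :|: Ss) :&: Ts = set0) ?cards0 ?subn0; last first.
  by apply/setP => x; rewrite !inE; apply/negP => /andP[/orP[] xA xT];
     [have := disjointFr dRT xA | have := disjointFr dST xA]; rewrite xT.
rewrite cardsU (_ : Rs :&: Ss = set0) ?cards0 ?subn0; last first.
  apply/setP => x; rewrite !inE; apply/negP => /andP[xA xT].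
  by have := disjointFr dRS xA; rewrite xT.
rewrite cS; move: #|Rs| #|Si| #|Ts| => r s t; clear; lia.
Qed.

Definition tight_census r si ti rho q a b sg : Prop :=
  [/\ (p + r)./2 = (rho + q)%N, (q + a <= ti)%N, (q + b = sg.+1)%N, (sg <= si)%N
    & (rho <= r)%N /\ p = (rho + 2 * q + a + b)%N].

Section Necessity.
Variables r si ti : nat.
Hypothesis rE : #|Rs| = r.
Hypothesis siE : #|Si| = si.
Hypothesis tiE : #|Ts| = ti.
Notation K := (tight_census r si ti).

Lemma tight_censusP W : tight_word W ->
  exists rho q a b sg, K rho q a b sg /\ word_census W rho q a b sg.
Proof.
move=> /andP[wW /eqP gW]; have [rho [q [a [b [sg cW]]]]] := censusP wW.
exists rho, q, a, b, sg; split=> //; split.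
- by rewrite -(census_gmc cW) gW /bound rE.
- by rewrite -tiE (census_T cW).
- exact: census_Seq cW.
- by rewrite -siE (census_S cW).
- by rewrite -rE (census_R cW); split=> //; apply: census_size cW.
Qed.

Definition census_all_visited := forall rho q a b sg, K rho q a b sg -> rho = r.
Definition census_no_a := forall rho q a b sg, K rho q a b sg -> a = 0%N.
Definition census_no_b := forall rho q a b sg, K rho q a b sg -> b = 0%N.

Lemma tight_visit : census_all_visited ->
  forall W, tight_word W -> forall w, w \in Rs -> w \in W.
Proof.
move=> vis W /tight_censusP[rho [q [a [b [sg [KW cW]]]]]].
by apply: (census_visit cW); rewrite rE; apply: vis KW.
Qed.

Lemma tight_no_a : census_no_a ->
  forall i j, i \notin Ss -> j \in Ts -> forall W, tight_word W -> (i, j) \notin arcs_of W.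
Proof.
move=> a0 i j iS jT W /tight_censusP[rho [q [a [b [sg [KW cW]]]]]].
by apply: (census_a cW) => //; apply: a0 KW.
Qed.

Lemma tight_no_b : census_no_b ->
  forall i j, i \in Ss -> j \notin Ts -> forall W, tight_word W -> (i, j) \notin arcs_of W.
Proof.
move=> b0 i j iS jT W /tight_censusP[rho [q [a [b [sg [KW cW]]]]]].
by apply: (census_b cW) => //; apply: b0 KW.
Qed.

Lemma visited_not_facet : census_all_visited ->
  [\/ (1 < r)%N, r = 1%N /\ (census_no_b \/ census_no_a /\ (0 < ti)%N)
    | r = 0%N /\ (census_no_b /\ (0 < si)%N \/ census_no_a /\ (1 < ti)%N)] -> ~ facet.
Proof.
move=> vis; case.
- rewrite -rE => /card_gt1P[w1 [w2 [w1R w2R ww]]].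
  exact: not_facet_RR w1R w2R ww (tight_visit vis).
- case=> r1 H; have /card_gt0P[w wR] : (0 < #|Rs|)%N by rewrite rE r1.
  have wK := in_nodeR dRS dRT S0 SN wR.
  have zw W : tight_word W -> w \in W by move=> tW; apply: (tight_visit vis tW).
  case: H => [b0|[a0]].
    have iw : all internal [:: w] by rewrite /= wK.
    have [Wf [_ _ w1 _]] := @extend_word [:: w] w isT iw p1_ge1.
    apply: (not_facet_R_arc wR w1 zw (tight_no_b b0 (i := ord0) (j := w) _ _)) => //.
    - by rewrite wK.
    - exact: arcs_of_first.
    - by rewrite inE eqxx.
  rewrite -tiE => /card_gt0P[t tT]; have tK := in_nodeT dRT dST S0 SN tT.
  have uwt : uniq [:: w; t].
    by rewrite /= inE andbT; apply: contraTneq wR => ->; rewrite tK.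
  have iwt : all internal [:: w; t] by rewrite /= wK tK.
  have [Wf [_ _ w1 _]] := extend_word w uwt iwt p1_ge2.
  apply: (not_facet_R_arc wR w1 zw (tight_no_a a0 (i := w) (j := t) _ _)) => //.
  - by rewrite wK.
  - exact: (arcs_of_cat [::] w t Wf).
  - by rewrite inE eqxx.
case=> _ [[b0]|[a0]].
  rewrite -siE => /card_gt0P[s /(in_inner_S dRS dST) sK].
  apply: (not_facet_first_last sK.2); apply: tight_no_b => //; rewrite ?sK //.
  by rewrite (ord_max_notin_T dST SN).
rewrite -tiE => /card_gt1P[t1 [t2 [t1T t2T tt]]].
have t1K := in_nodeT dRT dST S0 SN t1T; have t2K := in_nodeT dRT dST S0 SN t2T.
by apply: (not_facet_opposite t1K.2 t2K.2 tt); apply: tight_no_a => //; rewrite ?t1K ?t2K.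
Qed.

Lemma facet_necessary : facet ->
  [/\ odd (p + r), (p < 2 * si.+1 + r)%N, (p < 2 * ti + r)%N &
     [|| [&& p == r + 3, 2 <= r & si == 1] | r + 5 <= p]%N].
Proof.
move=> fct; have tot : (r + si + ti + 1 = n)%N by rewrite -rE -siE -tiE card_partition.
have nf : census_all_visited -> _ := fun vis H => visited_not_facet vis H fct.
have arith := (p_ge4, p_le, tot).
have odd_pr : odd (p + r).
  apply: contraT => ev; exfalso; apply: nf.
    by move=> ? ? ? ? ? [? ? ? ? [? ?]]; move: p_ge4 ev; nat_arith.
  have b0 : census_no_b by move=> ? ? ? ? ? [? ? ? ? [? ?]]; nat_arith.
  have a0 : census_no_a by move=> ? ? ? ? ? [? ? ? ? [? ?]]; nat_arith.
  case: (ltngtP r 1) => [r0|r1|r1]; [|exact: Or31|by apply: Or32; split=> //; left].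
  apply: Or33; split; first nat_arith.
  by case: (posnP si) => [si0|si0]; [right; split=> //; nat_arith | left].
have ltS : (p < 2 * si.+1 + r)%N.
  apply: contraT; rewrite -leqNgt => geS; exfalso; apply: nf.
    by move=> ? ? ? ? ? [? ? ? ? [? ?]]; nat_arith.
  have b0 : census_no_b by move=> ? ? ? ? ? [? ? ? ? [? ?]]; nat_arith.
  case: (ltngtP r 1) => [r0|r1|r1]; [|exact: Or31|by apply: Or32; split=> //; left].
  apply: Or33; split; first nat_arith.
  case: (posnP si) => [si0|si0]; [right|by left].
  by split; [move=> ? ? ? ? ? [? ? ? ? [? ?]]; nat_arith | nat_arith].
have ltT : (p < 2 * ti + r)%N.
  apply: contraT; rewrite -leqNgt => geT; exfalso; apply: nf.
    by move=> ? ? ? ? ? [? ? ? ? [? ?]]; nat_arith.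
  have a0 : census_no_a by move=> ? ? ? ? ? [? ? ? ? [? ?]]; nat_arith.
  case: (ltngtP r 1) => [r0|r1|r1]; [|exact: Or31|apply: Or32; split=> //].
    apply: Or33; split; first nat_arith.
    case: (ltnP 1 ti) => ti1; [by right | left].
    by split; [move=> ? ? ? ? ? [? ? ? ? [? ?]]; nat_arith | nat_arith].
  case: (posnP ti) => ti0; [left | by right].
  by move=> ? ? ? ? ? [? ? ? ? [? ?]]; nat_arith.
split=> //; case: (leqP (r + 5) p) => lt5; rewrite ?orbT // orbF.
case: (ltngtP p (r + 1)) => [p_lt|p_gt|p_eq]; last first.
- exfalso; have a0 : census_no_a by move=> ? ? ? ? ? [? ? ? ? [? ?]]; nat_arith.
  have /card_gt1P[w1 [w2 [w1R w2R ww]]] : (1 < #|Rs|)%N by rewrite rE; nat_arith.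
  have /card_gt0P[t tT] : (0 < #|Ts|)%N by rewrite tiE; nat_arith.
  have w1K := in_nodeR dRS dRT S0 SN w1R; have w2K := in_nodeR dRS dRT S0 SN w2R.
  have tK := in_nodeT dRT dST S0 SN tT.
  have ne w : w \in Rs -> w != t by move=> wR; apply: contraTneq wR => ->; rewrite tK.
  apply: (not_facet_common_head w1K.2 w2K.2 tK.2 ww (ne _ w1R) (ne _ w2R)) fct;
    by apply: (tight_no_a a0); rewrite ?tK ?w1K ?w2K.
- have p3 : p = (r + 3)%N by nat_arith.
  rewrite p3 eqxx /=; case: (ltngtP si 1) => [si0|si2|si1]; first by nat_arith.
    exfalso; move: si2; rewrite -siE => /card_gt1P[s1 [s2 [s1S s2S ss]]].
    have s1K := in_inner_S dRS dST s1S; have s2K := in_inner_S dRS dST s2S.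
    have un i j : i \in Si -> j \in Si -> i != j -> nodeS i -> nodeS j ->
        forall W, tight_word W -> (i, j) \notin arcs_of W.
      move=> iS jS ij iK jK W /[dup] /andP[wW _].
      move=> /tight_censusP[rho [q [a [b [sg [KW cW]]]]]].
      case: (posnP b) => [b0|b_gt0].
        by apply: (census_b cW b0); rewrite ?iK ?jK.
      have sg1 : (sg < 2)%N by case: KW => ? ? ? ? [? ?]; nat_arith.
      apply/negP => /(arcs_of_mem wW)[]; rewrite inE mem_rcons inE.
      have [/andP[/negPf i0 _] /andP[_ /negPf jN]] := (iK.2, jK.2).
      rewrite i0 jN /= => iW; apply/negP; exact: (census_2S cW sg1 iS jS ij iW).
    apply: (not_facet_opposite s1K.2 s2K.2 ss _ _ fct); first exact: un.
    by apply: un => //; rewrite eq_sym.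
  rewrite andbT; apply: contraT; rewrite -ltnNge => r1; exfalso.
  by apply: not_facet_small fct; rewrite ?rE ?siE ?tiE //; nat_arith.
exfalso; apply: nf; last by apply: Or31; nat_arith.
by move=> ? ? ? ? ? [? ? ? ? [? ?]]; nat_arith.
Qed.

End Necessity.
Lemma tight_word_exists k : (0 < k)%N -> (k <= #|Si|)%N -> (k < #|Ts|)%N ->
  p = (#|Rs| + 2 * k).+1 -> exists2 W, word p W & gmcw (ord0 :: W) = (#|Rs| + k)%N.
Proof.
move=> k0 leS ltT pE.
have /card_gt0P[s sS] := leq_trans k0 leS.
have /card_gt0P[t tT] := leq_ltn_trans (leq0n k) ltT.
have sK := in_inner_S dRS dST sS; have tK := in_nodeT dRT dST S0 SN tT.
have uL : uniq [:: s; t] by rewrite /= inE andbT; apply: contraTneq tT => <-; rewrite sK.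
have [||Wf fW] := @filler_exists n Rs Ss Ts dRS dRT dST S0 SN [:: s; t] k.-1 uL.
- by apply: leq_trans leS; rewrite /= sS inner_SE !tK /=; move: k0; clear; lia.
- by apply: leq_trans ltT; rewrite /= !tK sK /=; move: k0; clear; lia.
exists ([:: s; t] ++ Wf ++ [::]).
  apply: (filler_word fW); rewrite ?cats0 //= ?sK ?tK ?inE ?eqxx ?orbT //.
  by rewrite pE; move: #|Rs| k0 => r; clear; lia.
rewrite [LHS]/= (filler_gmcw fW) (ord0_notin_R dRS S0) S0 /= !sK !tK.
by move: #|Rs| k0 => r; clear; lia.
Qed.

Lemma facet_of_conditions k : p = (#|Rs| + 2 * k).+1 -> (0 < k)%N -> (k <= #|Si|)%N ->
  (k < #|Ts|)%N -> (1 < k)%N || (1 < #|Rs|)%N && (#|Si| == 1%N) -> facet.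
Proof.
move=> pE k0 leS ltT kr.
have boundE : bound = (#|Rs| + k)%N.
  by rewrite /bound pE; move: #|Rs| => r; clear; lia.
have /card_gt0P[s sS] := leq_trans k0 leS.
have /card_gt1P[t1 [t2 [t1T t2T tt]]] := leq_ltn_trans k0 ltT.
have sK := in_inner_S dRS dST sS.
have t1K := in_nodeT dRT dST S0 SN t1T; have t2K := in_nodeT dRT dST S0 SN t2T.
have uL : uniq [:: t1; t2; s].
  by rewrite /= !inE negb_or tt /= andbT; apply/andP; split; apply: contraTneq sS => <-;
    rewrite inner_SE ?t1K ?t2K.
have iL : all internal [:: t1; t2; s] by rewrite /= t1K t2K sK.
have p3 : (3 <= p.-1)%N by move: p_ge4; clear; lia.
(* A path ending t1 t2 s n has a >= 1 and b >= 1, hence is not tight. *)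
have [Wf [_ _ _ w0]] := extend_word s uL iL p3.
apply: (facet_words w0).
  apply/eqP => gE; have [rho [q [a [b [sg cW]]]]] := censusP w0.
  have a0 : a != 0%N.
    apply/eqP => /(census_a cW)/(_ t1 t2); rewrite t1K t2K => /(_ isT isT)/negP; apply.
    exact: (arcs_of_cat Wf t1 t2 [:: s]).
  have b0 : b != 0%N.
    apply/eqP => /(census_b cW)/(_ s N); rewrite sK (ord_max_notin_T dST SN).
    move=> /(_ isT isT)/negP; apply.
    by rewrite -[Wf ++ _]/(Wf ++ [:: t1; t2] ++ [:: s]) catA cats1 arcs_of_last.
  move: (census_gmc cW) (census_R cW) (census_size cW) a0 b0; rewrite gE boundE {1}pE.
  by move: #|Rs| => r; clear; lia.
move=> C C00 C0N Ctight.
pose c i j := C i j + (C ord0 i - C ord0 j).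
have cE W : cost c ord0 (rcons W N) = cost C ord0 (rcons W N).
  by rewrite cost_potential last_rcons C00 C0N subrr addr0.
have c0 x : c ord0 x = 0 by rewrite /c C00 sub0r subrr.
have tight0 W : word p W -> gmcw (ord0 :: W) = (#|Rs| + k)%N -> cost c ord0 (rcons W N) = 0.
  by move=> wW gW; rewrite cE Ctight // /tight_word wW gW boundE eqxx.
have [B [E [eps st]]] : exists B E eps, block_state Rs Ss Ts c B E eps.
  case/orP: kr => [k1|/andP[r1 /eqP s1]].
    exact: (block_state_gt1 n_gt0 dRS dRT dST S0 SN (erefl _) pE k0 leS ltT c0 tight0 k1).
  exact: (block_state_eq1 n_gt0 dRS dRT dST S0 SN (erefl _) pE k0 leS ltT c0 tight0 r1 s1).
have kr' : (1 < k)%N || (1 < #|Rs|)%N by case/orP: kr => [->|/andP[->]] //; rewrite orbT.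
have [cB eB] := block_state_structure n_gt0 dRS dRT dST cover_RST S0 SN (erefl _) pE k0 leS ltT c0
  tight0 st kr'.
have cW := cost_affine dRS dRT dST cover_RST S0 SN pE k0 c0 cB eB.
have [Wt wt gt] := tight_word_exists k0 leS ltT pE.
exists (E - eps) => W wW; have := cW _ wt; rewrite (tight0 _ wt gt) gt -cE cW // boundE.
by move=> H; apply/eqP; rewrite -subr_eq0 mulrBr; apply/eqP; lra.
Qed.

End PathPolytope.

Theorem theorem15 (F : realFieldType) (n p : nat) (Rs Ss Ts : {set 'I_n.+1}) :
  (0 < n)%N -> (4 <= p)%N -> (p <= n - 1)%N ->
  [disjoint Rs & Ss] -> [disjoint Rs & Ts] -> [disjoint Ss & Ts] ->
  Rs :|: Ss :|: Ts = [set: 'I_n.+1] ->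
  ord0 \in Ss -> ord_max \in Ss ->
  valid_ineq (Ppath F n p) (gmc_lhs Rs Ss Ts) ((p + #|Rs|)./2)%:R /\
  (facet_defining (Ppath F n p) (gmc_lhs Rs Ss Ts) ((p + #|Rs|)./2)%:R <->
   [/\ odd (p + #|Rs|),
       (p < 2 * #|Ss :\ ord_max| + #|Rs|)%N,
       (p < 2 * #|Ts| + #|Rs|)%N &
       ((p == #|Rs| + 3)%N && (2 <= #|Rs|)%N && (#|Ss| == 3)%N
        || (#|Rs| + 5 <= p)%N)]).
Proof.
move=> n_gt0 p_ge4 p_le dRS dRT dST cover_RST S0 SN.
rewrite (card_S_notN n_gt0 S0 SN) (card_inner_S n_gt0 S0 SN) !eqSS.
split; first exact: gmc_valid.
split=> [/(facet_necessary n_gt0 p_ge4 p_le dRS dRT dST cover_RST S0 SN erefl erefl erefl)|].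
  by case=> odd_pr ltS ltT cond; split=> //; rewrite -andbA.
case=> odd_pr ltS ltT cond.
have := @facet_of_conditions F n p Rs Ss Ts n_gt0 p_ge4 p_le dRS dRT dST cover_RST S0 SN
  ((p - #|Rs|).-1)./2.
move: #|Rs| #|inner_S Ss| #|Ts| odd_pr ltS ltT cond => r s t odd_pr ltS ltT cond.
by apply; move: odd_pr ltS ltT cond; clear; lia.
Qed.
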